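(* Assume that there is $\beta>0$, independent of $h$, such that $$\sup_{\mathbf 0\ne\mathbf u\in\mathbf H^h_0(\Omega_{\mathrm D})}\frac{(\mathrm{div}\,\mathbf u,q)_{\Omega_{\mathrm D}}}{\|\mathbf u\|_{\mathbf H(\mathrm{div},\Omega_{\mathrm D})}}\ge\beta\|q\|_{\Omega_{\mathrm D}}\quad\forall q\in L^h_0(\Omega_{\mathrm D}),\qquad\mathrm{div}\,\mathbf H^h(\Omega_{\mathrm D})\subset L^h(\Omega_{\mathrm D}).$$ Then: (i) The discrete flux-to-pressure operator is symmetric and nonnegative: for all $\phi,\psi\in\Phi^h_{\mathrm D}$, $$\langle\mathrm{FtP}_h(\phi),\psi\rangle_\Sigma=a_{\mathrm D}(\mathbf u_h^\phi,\mathbf u_h^\psi)=\langle\mathrm{FtP}_h(\psi),\phi\rangle_\Sigma,\qquad \langle\mathrm{FtP}_h(\phi),\phi\rangle_\Sigma\ge0.$$ (ii) The discrete Stokes–Darcy problem: find $(\mathbf u_h,p_h)\in\mathbb X^h\times\mathbb Q^h$ such that $$a(\mathbf u_h,\mathbf v)-b(\mathbf v,p_h)=(\mathbf f_{\mathrm S},\mathbf v_{\mathrm S})_{\Omega_{\mathrm S}}\ \ \forall\mathbf v\in\mathbb X^h,\qquad b(\mathbf u_h,q)=(f_{\mathrm D},q_{\mathrm D})_{\Omega_{\mathrm D}}\ \ \forall q\in\mathbb Q^h,\qquad(1)$$ is equivalent to: find $(\mathbf u^h_{\mathrm S},p^h_{\mathrm S})\in\mathbf V^h_{\mathrm S}(\Omega_{\mathrm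 S})\times L^h(\Omega_{\mathrm S})$ such that $$a_{\mathrm S}(\mathbf u^h_{\mathrm S},\mathbf v)+c_h(\mathbf u^h_{\mathrm S},\mathbf v)-b_{\mathrm S}(\mathbf v,p^h_{\mathrm S})=\ell_h(\mathbf v)\ \ \forall\mathbf v\in\mathbf V^h_{\mathrm S}(\Omega_{\mathrm S}),\qquad b_{\mathrm S}(\mathbf u^h_{\mathrm S},q)=0\ \ \forall q\in L^h(\Omega_{\mathrm S}).\qquad(2)$$ That is, if $((\mathbf u^h_{\mathrm S},\mathbf u^h_{\mathrm D}),(p^h_{\mathrm S},p^h_{\mathrm D}))$ solves (1), then $(\mathbf u^h_{\mathrm S},p^h_{\mathrm S})$ solves (2) and, with $\phi=R^h(\mathbf u^h_{\mathrm S}\cdot\mathbf n)$, $$\mathbf u^h_{\mathrm D}=\mathbf u_h^f+\mathbf u_h^\phi,\qquad p^h_{\mathrm D}=p_h^f+p_h^\phi;$$ conversely, if $(\mathbf u^h_{\mathrm S},p^h_{\mathrm S})$ solves (2) and $\mathbf u^h_{\mathrm D},p^h_{\mathrm D}$ are defined by these formulas, then $((\mathbf u^h_{\mathrm S},\mathbf u^h_{\mathrm D}),(p^h_{\mathrm S},p^h_{\mathrm D}))$ solves (1).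
   Context: Geometry and data. $\Omega\subset\mathbb R^d$ ($d=2,3$) is a bounded domain with polyhedral Lipschitz boundary, divided by a Lipschitz polyhedral interface $\Sigma$ into two subdomains $\Omega_{\mathrm S}$ and $\Omega_{\mathrm D}$; $\Gamma_{\mathrm S}=\partial\Omega_{\mathrm S}\setminus\Sigma$, $\Gamma_{\mathrm D}=\partial\Omega_{\mathrm D}\setminus\Sigma$. The unit normal $\mathbf n$ points outwards on $\partial\Omega$ and from $\Omega_{\mathrm S}$ to $\Omega_{\mathrm D}$ on $\Sigma$. $\nu>0$ is a constant, $\kappa$ is a positive bounded function on $\Sigma$, $\mathbf K(\mathbf x)$ is a symmetric matrix field with $0<k_1|\boldsymbol\xi|^2\le\mathbf K(\mathbf x)\boldsymbol\xi\cdot\boldsymbol\xi\le k_2|\boldsymbol\xi|^2$ for a.e. $\mathbf x\in\Omega_{\mathrm D}$ and all $\boldsymbol\xi\ne\mathbf 0$; $\mathbf f_{\mathrm S}\in\mathbf L^2(\Omega_{\mathrm S})$, $f_{\mathrm D}\in L^2(\Omega_{\mathrm D})$ with $\int_{\Omega_{\mathrm D}}f_{\mathrm D}=0$. $(\cdot,\cdot)_{\mathcal O}$, $\|\cdot\|_{\mathcal O}$ are the $L^2(\mathcal O)$ inner product and norm, $\langle\cdot,\cdot\rangle_\Sigma$ the $L^2(\Sigma)$ product (or evaluation of a functional), $\boldsymbol\varepsilon(\mathbf u)=\frac12(\nabla\mathbf u+\nabla^\top\mathbf u)$, $\boldsymbol\pi_t\mathbf w=\mathbf w-(\mathbf w\cdot\mathbf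 n)\mathbf n$, $L^2_0(\mathcal O)=\{p\in L^2(\mathcal O):(p,1)_{\mathcal O}=0\}$. Bilinear forms: $a_{\mathrm S}(\mathbf u,\mathbf v)=2\nu(\boldsymbol\varepsilon(\mathbf u),\boldsymbol\varepsilon(\mathbf v))_{\Omega_{\mathrm S}}+\langle\kappa\boldsymbol\pi_t\mathbf u,\boldsymbol\pi_t\mathbf v\rangle_\Sigma$, $a_{\mathrm D}(\mathbf u,\mathbf v)=(\mathbf K^{-1}\mathbf u,\mathbf v)_{\Omega_{\mathrm D}}$, $b_{\mathrm S}(\mathbf u,q)=(\mathrm{div}\,\mathbf u,q)_{\Omega_{\mathrm S}}$, $b_{\mathrm D}(\mathbf u,q)=(\mathrm{div}\,\mathbf u,q)_{\Omega_{\mathrm D}}$; for pairs, $a(\mathbf u,\mathbf v)=a_{\mathrm S}(\mathbf u_{\mathrm S},\mathbf v_{\mathrm S})+a_{\mathrm D}(\mathbf u_{\mathrm D},\mathbf v_{\mathrm D})$ and $b(\mathbf u,q)=b_{\mathrm S}(\mathbf u_{\mathrm S},q_{\mathrm S})+b_{\mathrm D}(\mathbf u_{\mathrm D},q_{\mathrm D})$. Discrete spaces. For each $h$, relative to shape-regular simplicial triangulations of $\overline\Omega_{\mathrm S}$ and $\overline\Omega_{\mathrm D}$ with elements of diameter at most $h$, there are finite dimensional spaces of piecewise polynomials $\mathbf V^h(\Omega_{\mathrm S})\subset\mathbf H^1(\Omega_{\mathrm S})$, $L^h_0(\Omega_{\mathrm S})\subset L^2_0(\Omega_{\mathrm S})$,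 $L^h(\Omega_{\mathrm S})=L^h_0(\Omega_{\mathrm S})\oplus\mathbb P_0(\Omega_{\mathrm S})$, $\mathbf H^h(\Omega_{\mathrm D})\subset\mathbf H(\mathrm{div},\Omega_{\mathrm D})$, $L^h_0(\Omega_{\mathrm D})\subset L^2_0(\Omega_{\mathrm D})$, $L^h(\Omega_{\mathrm D})=L^h_0(\Omega_{\mathrm D})\oplus\mathbb P_0(\Omega_{\mathrm D})$ ($\mathbb P_0$ = constants). Set $\mathbf V^h_{\mathrm S}(\Omega_{\mathrm S})=\{\mathbf v\in\mathbf V^h(\Omega_{\mathrm S}):\mathbf v=\mathbf 0\text{ on }\Gamma_{\mathrm S}\}$, $\mathbf H^h_{\mathrm D}(\Omega_{\mathrm D})=\{\mathbf v\in\mathbf H^h(\Omega_{\mathrm D}):\mathbf v\cdot\mathbf n=0\text{ on }\Gamma_{\mathrm D}\}$, $\mathbf H^h_0(\Omega_{\mathrm D})=\{\mathbf v\in\mathbf H^h(\Omega_{\mathrm D}):\mathbf v\cdot\mathbf n=0\text{ on }\partial\Omega_{\mathrm D}\}$, $\Phi^h_{\mathrm D}=\{\mathbf v\cdot\mathbf n|_\Sigma:\mathbf v\in\mathbf H^h_{\mathrm D}(\Omega_{\mathrm D})\}\subset L^2(\Sigma)$. It is assumed that $\Phi^h_{\mathrm D}$ contains the piecewise constant functions on the partition of $\Sigma$ inherited from the triangulation of $\Omega_{\mathrm D}$. $R^h$ is the $L^2(\Sigma)$-orthogonal projection onto $\Phi^h_{\mathrm D}$. Put $$\mathbb X^h=\{(\mathbf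 u_{\mathrm S},\mathbf u_{\mathrm D})\in\mathbf V^h_{\mathrm S}(\Omega_{\mathrm S})\times\mathbf H^h_{\mathrm D}(\Omega_{\mathrm D}):\mathbf u_{\mathrm D}\cdot\mathbf n=R^h(\mathbf u_{\mathrm S}\cdot\mathbf n)\text{ on }\Sigma\},\qquad\mathbb Q^h=L^h(\Omega_{\mathrm S})\times L^h_0(\Omega_{\mathrm D}).$$ Discrete flux-to-pressure operator. For $\phi\in\Phi^h_{\mathrm D}$ let $(\mathbf u_h^\phi,p_h^\phi)\in\mathbf H^h_{\mathrm D}(\Omega_{\mathrm D})\times L^h_0(\Omega_{\mathrm D})$ be the solution of $\mathbf u_h^\phi\cdot\mathbf n=\phi$ on $\Sigma$, $a_{\mathrm D}(\mathbf u_h^\phi,\mathbf v)-b_{\mathrm D}(\mathbf v,p_h^\phi)=0$ for all $\mathbf v\in\mathbf H^h_0(\Omega_{\mathrm D})$, $b_{\mathrm D}(\mathbf u_h^\phi,q)=0$ for all $q\in L^h_0(\Omega_{\mathrm D})$. The functional $\mathrm{FtP}_h(\phi):\Phi^h_{\mathrm D}\to\mathbb R$ is defined by $\langle\mathrm{FtP}_h(\phi),\mathbf v\cdot\mathbf n\rangle_\Sigma=a_{\mathrm D}(\mathbf u_h^\phi,\mathbf v)-b_{\mathrm D}(\mathbf v,p_h^\phi)$ for all $\mathbf v\in\mathbf H^h_{\mathrm D}(\Omega_{\mathrm D})$. Source terms. $(\mathbf u_h^f,p_h^f)\in\mathbf H^h_0(\Omega_{\mathrm D})\times L^h_0(\Omega_{\mathrm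 D})$ solves $a_{\mathrm D}(\mathbf u_h^f,\mathbf v)-b_{\mathrm D}(\mathbf v,p_h^f)=0$ for all $\mathbf v\in\mathbf H^h_0(\Omega_{\mathrm D})$ and $b_{\mathrm D}(\mathbf u_h^f,q)=(f_{\mathrm D},q)_{\Omega_{\mathrm D}}$ for all $q\in L^h_0(\Omega_{\mathrm D})$; the functional $\gamma_h^f:\Phi^h_{\mathrm D}\to\mathbb R$ is defined by $\langle\gamma_h^f,\mathbf v\cdot\mathbf n\rangle_\Sigma=a_{\mathrm D}(\mathbf u_h^f,\mathbf v)-b_{\mathrm D}(\mathbf v,p_h^f)$ for all $\mathbf v\in\mathbf H^h_{\mathrm D}(\Omega_{\mathrm D})$. Finally, for $\mathbf u,\mathbf v\in\mathbf V^h_{\mathrm S}(\Omega_{\mathrm S})$, $c_h(\mathbf u,\mathbf v)=\langle\mathrm{FtP}_h(R^h(\mathbf u\cdot\mathbf n)),R^h(\mathbf v\cdot\mathbf n)\rangle_\Sigma$ and $\ell_h(\mathbf v)=(\mathbf f_{\mathrm S},\mathbf v)_{\Omega_{\mathrm S}}-\langle\gamma_h^f,R^h(\mathbf v\cdot\mathbf n)\rangle_\Sigma$. *)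

(* Defs.v *)
From HB Require Import structures.
From mathcomp Require Import all_boot all_order all_algebra.
From mathcomp Require Import all_classical all_reals all_analysis.
From mathcomp Require mpoly.
From mathcomp Require Import lra.
Set Implicit Arguments.
Unset Strict Implicit.
Unset Printing Implicit Defensive.
Import Order.TTheory GRing.Theory Num.Theory.
Import numFieldTopology.Exports numFieldNormedType.Exports.
Local Open Scope classical_set_scope.
Local Open Scope ring_scope.

Section cover_measure.
Context (R : realType) (T I : Type).
Variables (P : set I) (E : I -> set T) (w : I -> \bar R).
Local Open Scope ereal_scope.

(* The outer measure obtained from countable covers by the sets E i, P i, of
   weight w i; None stands for an empty set of weight 0. *)
Definition is_cover (A : set T) (s : nat -> option I) :=
  (forall k i, s k = Some i -> P i) /\
  A `<=` \bigcup_k oapp E set0 (s k).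

Definition cover_sum (s : nat -> option I) : \bar R :=
  \sum_(k <oo) oapp w 0 (s k).

Definition cover_measure (A : set T) : \bar R :=
  ereal_inf [set cover_sum s | s in is_cover A].

Hypothesis w0 : forall i, P i -> 0 <= w i.

Lemma cover_term_ge0 A s k : is_cover A s -> 0 <= oapp w 0 (s k).
Proof. by move=> [+ _] => /(_ k); case: (s k) => //= i /(_ i erefl)/w0. Qed.

Lemma cover_sum_ge0 A s : is_cover A s -> 0 <= cover_sum s.
Proof. by move=> cs; apply: nneseries_ge0 => k _ _; exact: (cover_term_ge0 _ cs). Qed.

Lemma cover_measure_ge0 A : 0 <= cover_measure A.
Proof. by apply/le_ereal_inf_tmp => _ [s cs <-]; exact: cover_sum_ge0 cs. Qed.

Lemma cover_measure_set0 : cover_measure set0 = 0.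
Proof.
apply/eqP; rewrite eq_le cover_measure_ge0 andbT; apply: ereal_inf_lbound.
exists (fun=> None); first by split.
by rewrite /cover_sum eseries0.
Qed.

Lemma le_cover_measure : {homo cover_measure : A B / A `<=` B >-> A <= B}.
Proof.
move=> A B AB; apply/ereal_inf_le_tmp => _ [s [sP Bs] <-].
by exists s => //; split => //; exact: subset_trans Bs.
Qed.

Lemma cover_measure_sigma_subadditive : sigma_subadditive cover_measure.
Proof.
move=> A; have [[i ioo]|] := pselect (exists i, cover_measure (A i) = +oo).
  rewrite (eseries_pinfty _ _ ioo) ?leey// => n _.
  by rewrite -ltNye (lt_le_trans _ (cover_measure_ge0 _)).
rewrite -forallNE => Aoo.
suff add2e (e : {posnum R}) :
    cover_measure (\bigcup_n A n) <=
    \sum_(i <oo) cover_measure (A i) + e%:num%:E.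
  by apply/lee_addgt0Pr => _/posnumP[].
rewrite (le_trans _ (epsilon_trick _ _ _))//; last first.
  by move=> n; exact: cover_measure_ge0.
pose Q n (B : nat -> option I) := is_cover (A n) B /\
  cover_sum B <= cover_measure (A n) + (e%:num / (2 ^ n.+1)%:R)%:E.
have [G PG] : {G : nat -> nat -> option I & forall n, Q n (G n)}.
  apply: (@choice _ _ Q) => n.
  have en1 : (0 < e%:num / (2 ^ n.+1)%:R)%R by [].
  have finA : cover_measure (A n) \is a fin_num.
    rewrite ge0_fin_numE ?cover_measure_ge0// ltey; exact/eqP/Aoo.
  have [_ [B cB <-] xS] := lb_ereal_inf_adherent en1 finA.
  by exists B; split => //; exact/ltW.
pose g (p : nat * nat) := oapp w 0 (G p.1 p.2).
have g_ge0 x : 0 <= g x by exact: (cover_term_ge0 _ (PG x.1).1).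
apply: (@le_trans _ _ (\esum_(i in setT) g i)).
  apply: ereal_inf_lbound => /=.
  have /card_esym/ppcard_eqP[f] := card_nat2.
  exists (uncurry G \o f).
    split => [k i Gki|].
      apply: ((PG (f k).1).1.1 (f k).2); move: Gki => /=.
      by case: (f k).
    move=> t [i _ /(PG i).1.2 [j _ ?]].
    exists (f^-1%FUN (i, j)) => //=.
    by rewrite invK ?inE.
  rewrite /cover_sum.
  rewrite (_ : (fun k => _) = (fun k => \sum_(0 <= i < k | xpredT i) g (f i))); last first.
    by apply/funext => k; apply: eq_bigr => i _; rewrite /g /=; case: (f i).
  rewrite -(esum_pred_image g _ xpredT) ?[fun=> _]set_true//.
  by rewrite image_eq.
rewrite (_ : esum _ _ = \sum_(i <oo) \sum_(j <oo ) g (i, j)); last first.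
  pose J : nat -> set (nat * nat) := fun i => [set (i, j) | j in setT].
  rewrite (_ : setT = \bigcup_k J k); last first.
    by rewrite predeqE => -[a b]; split => // _; exists a => //; exists b.
  rewrite esum_bigcupT /=; last 2 first.
    - apply/trivIsetP => i j _ _ ij.
      rewrite predeqE => -[n m] /=; split => //= -[] [_] _ [<-{n} _].
      by move=> [m' _] [] /esym/eqP; rewrite (negbTE ij).
    - by move=> p; exact: g_ge0.
  rewrite -(image_id [set: nat]) -fun_true esum_pred_image//; last first.
    by move=> n _; exact: esum_ge0.
  apply: eq_eseriesr => /= j _.
  rewrite -(esum_pred_image g (pair j) predT)//=; last first.
    by move=> ? ? _ _; exact: (@can_inj _ _ _ snd).
  by congr esum; rewrite predeqE => -[a b]; split; move=> [i _ <-]; exists i.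
apply: lee_lim.
- apply: is_cvg_nneseries => n *.
  by apply: nneseries_ge0 => m *; exact: (g_ge0 (n, m)).
- by apply: is_cvg_nneseries => n *; apply: adde_ge0 => //; exact: cover_measure_ge0.
- by near=> n; apply: lee_sum => i _; exact: (PG i).2.
Unshelve. all: by end_near. Qed.

Lemma cover_measure_split (A B : set T) :
  (forall i, P i -> exists j1 j2 : option I,
    [/\ (forall i', j1 = Some i' -> P i') /\ (forall i', j2 = Some i' -> P i'),
        E i `&` A `<=` oapp E set0 j1, E i `&` B `<=` oapp E set0 j2 &
        oapp w 0 j1 + oapp w 0 j2 <= w i]) ->
  cover_measure A + cover_measure B <= cover_measure (A `|` B).
Proof.
move=> H; apply/le_ereal_inf_tmp => _ [s [sP ABs] <-].
pose Q (o : option I) (j : option I * option I) :=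
  [/\ (forall i', j.1 = Some i' -> P i') /\ (forall i', j.2 = Some i' -> P i'),
     oapp E set0 o `&` A `<=` oapp E set0 j.1,
     oapp E set0 o `&` B `<=` oapp E set0 j.2 &
     oapp w 0 j.1 + oapp w 0 j.2 <= oapp w 0 o].
have [f fQ] : {f : nat -> option I * option I & forall k, Q (s k) (f k)}.
  apply: (@choice _ _ (fun k => Q (s k))) => k; have := sP k.
  case: (s k) => [i /(_ i erefl)/H [j1 [j2 H12]]|_]; first by exists (j1, j2).
  by exists (None, None); split=> //=; rewrite ?set0I// adde0.
have c1 : is_cover A (fst \o f).
  split=> [k i fi|x Ax]; first by have [[h _] _ _ _] := fQ k; exact: (h i).
  by have [k _ sx] := ABs x (or_introl Ax); exists k => //; have [_ h _ _] := fQ k; exact: h.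
have c2 : is_cover B (snd \o f).
  split=> [k i fi|x Ax]; first by have [[_ h] _ _ _] := fQ k; exact: (h i).
  by have [k _ sx] := ABs x (or_intror Ax); exists k => //; have [_ _ h _] := fQ k; exact: h.
apply: (@le_trans _ _ (cover_sum (fst \o f) + cover_sum (snd \o f))).
  by apply: leeD; apply: ereal_inf_lbound; eexists; eauto.
rewrite /cover_sum -nneseriesD; last 2 first.
- by move=> k _ _; exact: (cover_term_ge0 k c1).
- by move=> k _ _; exact: (cover_term_ge0 k c2).
apply: lee_nneseries => k _; last by case: (fQ k).
move=> _; apply: adde_ge0; [exact: (cover_term_ge0 k c1)|exact: (cover_term_ge0 k c2)].
Qed.

End cover_measure.

Definition rV_display : measure_display.
Proof. exact: default_measure_display. Qed.

Section rV_measurable.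
Context (R : realType) (d : nat).

Let coord (i : 'I_d) (x : 'rV[R]_d) : measurableTypeR R := x ord0 i.

Let rV_set0 : g_sigma_preimage coord set0.
Proof. exact: sigma_algebra0. Qed.

Let rV_setC A : g_sigma_preimage coord A -> g_sigma_preimage coord (~` A).
Proof. exact: sigma_algebraC. Qed.

Let rV_bigcup (F : _^nat) : (forall i, g_sigma_preimage coord (F i)) ->
  g_sigma_preimage coord (\bigcup_i (F i)).
Proof. exact: sigma_algebra_bigcup. Qed.

(* The Borel sigma-algebra of R^d, generated by the coordinates as in
   the library's instance for tuples. *)
HB.instance Definition _ := @isMeasurable.Build rV_display
  'rV[R]_d (g_sigma_preimage coord) rV_set0 rV_setC rV_bigcup.

Lemma rV_measurable_caratheodory (mu : {outer_measure set 'rV[R]_d -> \bar R}) :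
  (forall i c, mu.-caratheodory [set x | c < x ord0 i]) ->
  forall A : set 'rV[R]_d, measurable A -> mu.-caratheodory A.
Proof.
move=> H; apply: smallest_sub => [|B].
  split => [|A mA|F mF]; first exact: caratheodory_measurable_set0.
    by rewrite setTD; exact: caratheodory_measurable_setC.
  exact: caratheodory_measurable_bigcup.
rewrite -bigcup_seq => -[i _ [C mC <-]]; rewrite setTI.
have {}mC : (@ocitv R).-sigma.-measurable C by [].
rewrite measurable_realfun.RGenOInfty.measurableE in mC.
move: C mC; apply: smallest_sub => [|_ [c ->]].
  split => [|A mA|F mF].
  - by rewrite /= preimage_set0; exact: caratheodory_measurable_set0.
  - rewrite /= setTD preimage_setC; exact: caratheodory_measurable_setC.
  - rewrite /= preimage_bigcup; exact: caratheodory_measurable_bigcup.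
rewrite /=; suff -> : coord i @^-1` `]c, +oo[ = [set x | c < x ord0 i] by [].
by apply/seteqP; split => x; rewrite /= in_itv/= andbT.
Qed.
End rV_measurable.

Section rV_measure.
Context (R : realType) (d : nat) (mu : {outer_measure set 'rV[R]_d -> \bar R}).
Hypothesis mu_halfspace :
  forall i c, mu.-caratheodory [set x : 'rV[R]_d | c < x ord0 i].

Lemma rV_measure_sigma_additive :
  semi_sigma_additive (mu : set 'rV[R]_d -> \bar R).
Proof.
move=> A mA tA mUA.
have H (B : set 'rV[R]_d) : measurable B -> mu.-caratheodory B.
  exact: (rV_measurable_caratheodory mu_halfspace).
exact: (@caratheodory_measure_sigma_additive _ _ mu A
  (fun i => H _ (mA i)) tA (H _ mUA)).
Qed.

End rV_measure.

(* Lebesgue measure on R^d, from covers by closed boxes. *)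
Section lebesgue.
Context (R : realType) (d : nat).

Definition box (ab : 'rV[R]_d * 'rV[R]_d) : set 'rV[R]_d :=
  [set x : 'rV[R]_d | forall i, ab.1 ord0 i <= x ord0 i <= ab.2 ord0 i].

Definition box_wf : set ('rV[R]_d * 'rV[R]_d) :=
  [set ab : 'rV[R]_d * 'rV[R]_d | forall i, ab.1 ord0 i <= ab.2 ord0 i].

Definition box_volume (ab : 'rV[R]_d * 'rV[R]_d) : \bar R :=
  (\prod_i (ab.2 ord0 i - ab.1 ord0 i))%:E.

Definition lebesgue : set 'rV[R]_d -> \bar R :=
  cover_measure box_wf box box_volume.

Lemma box_volume_ge0 ab : box_wf ab -> (0 <= box_volume ab)%E.
Proof. by move=> H; rewrite lee_fin; apply: prodr_ge0 => i _; rewrite subr_ge0. Qed.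

HB.instance Definition _ := isOuterMeasure.Build R 'rV[R]_d lebesgue
  (cover_measure_set0 box box_volume_ge0)
  (cover_measure_ge0 box box_volume_ge0)
  (@le_cover_measure R _ _ box_wf box box_volume)
  (@cover_measure_sigma_subadditive R _ _ _ box _ box_volume_ge0).

Lemma lebesgue_halfspace i c :
  lebesgue.-caratheodory [set x : 'rV[R]_d | c < x ord0 i].
Proof.
apply: le_caratheodory_measurable => X.
set H := [set x | _].
apply: (@le_trans _ _ (lebesgue (X `&` H `|` X `&` ~` H))); last first.
  by rewrite -setIUr setUCr setIT.
apply: cover_measure_split; first exact: box_volume_ge0.
move=> [a b] ab_wf.
have [bc|cb] := leP (b ord0 i) c.
  exists None, (Some (a, b)); split => //=; first by split=> // _ [<-].
  - move=> x [/(_ i)/andP[_ xb] [_ cx]]; move: (lt_le_trans cx xb).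
    by rewrite ltNge bc.
  - by rewrite add0e.
have [ca|ac] := ltP c (a ord0 i).
  exists (Some (a, b)), None; split => //=; first by split=> // _ [<-].
  - move=> x [/(_ i)/andP[ax _] [_ /= /negP]]; rewrite -leNgt => xc.
    by move: (le_lt_trans (le_trans ax xc) ca); rewrite ltxx.
  - by rewrite adde0.
pose a' : 'rV[R]_d := \row_j if j == i then c else a ord0 j.
pose b' : 'rV[R]_d := \row_j if j == i then c else b ord0 j.
exists (Some (a', b)), (Some (a, b')); split => /=.
- split=> _ [<-] j; rewrite /= mxE; case: eqP => [->//|_]; [exact: ltW|exact: ab_wf|exact: ab_wf].
- move=> x [xab [_ cx]] j; rewrite /= mxE; have /andP[] := xab j.
  by case: eqP => [->|_] h1 ->; rewrite andbT// ltW.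
- move=> x [xab [_ /negP]]; rewrite -leNgt => xc j; rewrite /= mxE.
  by have /andP[] := xab j; case: eqP => [->|_] -> //.
- rewrite /box_volume/= -EFinD lee_fin.
  rewrite (bigD1 i)//= [X in _ + X](bigD1 i)//= [leRHS](bigD1 i)//= !mxE eqxx.
  rewrite (eq_bigr (fun j => b ord0 j - a ord0 j)); last first.
    by move=> j /negbTE ji; rewrite mxE ji.
  rewrite [X in _ + _ * X](eq_bigr (fun j => b ord0 j - a ord0 j)); last first.
    by move=> j /negbTE ji; rewrite mxE ji.
  by rewrite -mulrDl [_ - _ + _]addrA subrK.
Qed.

HB.instance Definition _ := isMeasure.Build rV_display 'rV[R]_d R lebesgue
  (outer_measure0 lebesgue) (outer_measure_ge0 lebesgue)
  (rV_measure_sigma_additive lebesgue_halfspace).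

End lebesgue.

Definition dot (R : realType) (d : nat) (x y : 'rV[R]_d) : R :=
  \sum_i x ord0 i * y ord0 i.

Definition enorm (R : realType) (d : nat) (x : 'rV[R]_d) : R :=
  Num.sqrt (dot x x).

Lemma coord_le_enorm (R : realType) (d : nat) (x : 'rV[R]_d) i :
  `|x ord0 i| <= enorm x.
Proof.
rewrite /enorm /dot -sqrtr_sqr ler_wsqrtr// expr2 (bigD1 i)//= lerDl.
by apply: sumr_ge0 => j _; rewrite -expr2 sqr_ge0.
Qed.

(* k-dimensional Hausdorff measure on R^d, for the Euclidean distance, with the
   usual normalization by the volume of the unit ball of R^k. On polyhedral
   surfaces, k = d.-1 gives the surface area. *)
Section hausdorff.
Context (R : realType) (d : nat) (k : nat).
Local Open Scope ereal_scope.

Definition diameter (A : set 'rV[R]_d) : \bar R :=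
  ereal_sup (0 |` [set (enorm (x - y))%:E | x in A & y in A]).

Lemma diameter_ge0 A : 0 <= diameter A.
Proof. by apply: ereal_sup_ubound; left. Qed.

Definition hausdorff_weight (A : set 'rV[R]_d) : \bar R :=
  (fine (lebesgue [set x : 'rV[R]_k | (enorm x <= 1)%R]) / 2 ^+ k)%:E *
  diameter A ^+ k.

Lemma hausdorff_weight_ge0 A : 0 <= hausdorff_weight A.
Proof.
apply: mule_ge0; last by apply: expe_ge0; exact: diameter_ge0.
by rewrite lee_fin divr_ge0 ?exprn_ge0// fine_ge0//; exact: outer_measure_ge0.
Qed.

Definition hausdorff_delta (delta : R) : set 'rV[R]_d -> \bar R :=
  cover_measure [set A | diameter A <= delta%:E] id hausdorff_weight.

Definition hausdorff (A : set 'rV[R]_d) : \bar R :=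
  ereal_sup [set hausdorff_delta delta A | delta in [set delta | (0 < delta)%R]].

Lemma hausdorff_delta_ge0 delta A : 0 <= hausdorff_delta delta A.
Proof. by apply: cover_measure_ge0 => C _; exact: hausdorff_weight_ge0. Qed.

Lemma hausdorff_ge0 A : 0 <= hausdorff A.
Proof.
apply: (le_trans (hausdorff_delta_ge0 1 A)).
by apply: ereal_sup_ubound; exists 1%R => //=.
Qed.

Lemma hausdorff_set0 : hausdorff set0 = 0.
Proof.
apply/eqP; rewrite eq_le hausdorff_ge0 andbT.
apply: ge_ereal_sup => _ [e _ <-].
by rewrite /hausdorff_delta cover_measure_set0// => C _; exact: hausdorff_weight_ge0.
Qed.

Lemma le_hausdorff : {homo hausdorff : A B / A `<=` B >-> A <= B}.
Proof.
move=> A B AB; apply: ge_ereal_sup => _ [e e0 <-].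
apply: (@le_trans _ _ (hausdorff_delta e B)); first exact: le_cover_measure.
by apply: ereal_sup_ubound; exists e.
Qed.

Lemma hausdorff_sigma_subadditive : sigma_subadditive hausdorff.
Proof.
move=> F; apply: ge_ereal_sup => _ [e e0 <-].
have w0 C : diameter C <= e%:E -> 0 <= hausdorff_weight C.
  by move=> _; exact: hausdorff_weight_ge0.
apply: (le_trans (cover_measure_sigma_subadditive id w0 F)).
apply: lee_nneseries => i _; first by move=> _; exact: hausdorff_delta_ge0.
by apply: ereal_sup_ubound; exists e.
Qed.

HB.instance Definition _ := isOuterMeasure.Build R 'rV[R]_d hausdorff
  hausdorff_set0 hausdorff_ge0 le_hausdorff hausdorff_sigma_subadditive.

Lemma hausdorff_delta_le e e' A : (e <= e')%R ->
  hausdorff_delta e' A <= hausdorff_delta e A.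
Proof.
move=> ee'; apply/ereal_inf_le_tmp => _ [s [sP As] <-]; exists s => //.
by split => // n C /sP /= /le_trans; apply; rewrite lee_fin.
Qed.

Lemma hausdorff_metric (r : R) (A B : set 'rV[R]_d) : (0 < r)%R ->
  (forall x y, A x -> B y -> (r <= enorm (x - y))%R) ->
  hausdorff A + hausdorff B <= hausdorff (A `|` B).
Proof.
move=> r0 rAB.
have [->|ABoo] := eqVneq (hausdorff (A `|` B)) +oo; first by rewrite leey.
have finAB : hausdorff (A `|` B) \is a fin_num.
  by rewrite ge0_fin_numE ?hausdorff_ge0// ltey.
have key (e1 e2 : R) : (0 < e1)%R -> (0 < e2)%R ->
    hausdorff_delta e1 A + hausdorff_delta e2 B <= hausdorff (A `|` B).
  move=> e10 e20; pose e : R := Num.min (r / 2)%R (Num.min e1 e2).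
  have er : (e < r)%R.
    by apply: (@le_lt_trans _ _ (r / 2)%R); [rewrite ge_min lexx|lra].
  apply: (@le_trans _ _ (hausdorff_delta e A + hausdorff_delta e B)).
    by apply: leeD; apply: hausdorff_delta_le; rewrite /e !ge_min lexx !orbT.
  apply: (@le_trans _ _ (hausdorff_delta e (A `|` B))); last first.
    by apply: ereal_sup_ubound; exists e => //=; rewrite !lt_min e10 e20 divr_gt0.
  apply: cover_measure_split; first by move=> C _; exact: hausdorff_weight_ge0.
  move=> C /= Ce.
  have [[x [Cx Ax]]|CA0] := pselect (exists x, C x /\ A x).
    exists (Some C), None; split => //=; first by split=> // _ [<-].
    - move=> y [Cy By].
      have := le_trans _ Ce => /(_ (enorm (x - y))%:E).
      have -> : (enorm (x - y))%:E <= diameter C.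
        by apply: ereal_sup_ubound; right; exists x => //; exists y.
      move=> /(_ isT); rewrite lee_fin => h.
      by have := le_lt_trans (le_trans (rAB x y Ax By) h) er; rewrite ltxx.
    - by rewrite adde0.
  exists None, (Some C); split => //=; first by split=> // _ [<-].
  - by move=> x [Cx Ax]; apply: CA0; exists x.
  - by rewrite add0e.
have finle X : hausdorff X <= hausdorff (A `|` B) -> hausdorff X \is a fin_num.
  by move=> h; rewrite ge0_fin_numE ?hausdorff_ge0// (le_lt_trans h)// ltey.
have finB : hausdorff B \is a fin_num.
  by apply: finle; apply: le_hausdorff => x; right.
rewrite -leeBrDr//; apply: ge_ereal_sup => _ [e1 e10 <-].
rewrite leeBrDr// addeC.
have fin1 : hausdorff_delta e1 A \is a fin_num.
  rewrite ge0_fin_numE ?hausdorff_delta_ge0//; apply: le_lt_trans (_ : hausdorff A < +oo).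
    by apply: ereal_sup_ubound; exists e1.
  rewrite -ge0_fin_numE ?hausdorff_ge0//.
  by apply: finle; apply: le_hausdorff => x; left.
rewrite -leeBrDr//; apply: ge_ereal_sup => _ [e2 e20 <-].
by rewrite leeBrDr// addeC; exact: key.
Qed.

Lemma hausdorff_halfspace i c :
  hausdorff.-caratheodory [set x : 'rV[R]_d | (c < x ord0 i)%R].
Proof.
set H := [set x | _].
suff main X : hausdorff (X `&` H) + hausdorff (X `&` ~` H) <= hausdorff X.
  exact: le_caratheodory_measurable main.
have [->|Xoo] := eqVneq (hausdorff X) +oo; first by rewrite leey.
have finX Y : Y `<=` X -> hausdorff Y \is a fin_num.
  move=> YX; rewrite ge0_fin_numE ?hausdorff_ge0//.
  by apply: (le_lt_trans (le_hausdorff YX)); rewrite ltey.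
pose t n : R := (c + n.+1%:R^-1)%R.
pose A n := X `&` [set x | (t n <= x ord0 i)%R].
pose D n := X `&` [set x | (t n.+1 <= x ord0 i < t n)%R].
have tdec m n : (m <= n)%N -> (t n <= t m)%R.
  by move=> mn; rewrite /t lerD2l lef_pV2 ?posrE// ler_nat ltnS.
have tdec' m n : (m < n)%N -> (t n < t m)%R.
  by move=> mn; rewrite /t ltrD2l ltf_pV2 ?posrE// ltr_nat ltnS.
have sep (x y : 'rV[R]_d) (r : R) : (r <= x ord0 i - y ord0 i)%R -> (r <= enorm (x - y))%R.
  move=> /le_trans; apply; apply: (le_trans _ (coord_le_enorm _ i)).
  by rewrite !mxE ler_norm.
have XA n : hausdorff (A n) + hausdorff (X `&` ~` H) <= hausdorff X.
  apply: (@le_trans _ _ (hausdorff (A n `|` (X `&` ~` H)))); last first.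
    by apply: le_hausdorff => x [[]|[]].
  apply: (@hausdorff_metric (n.+1%:R^-1)) => [|x y [_ /= tx] [_ /= /negP]].
    by rewrite invr_gt0.
  rewrite -leNgt => yc; apply: sep.
  by rewrite lerBrDr (le_trans _ tx)// /t addrC lerD2r.
have Dsum b n : \sum_(j < n) hausdorff (D (j.*2 + b)%N) <= hausdorff X.
  pose F j := D (j.*2 + b)%N.
  rewrite -[leLHS]/(\sum_(j < n) hausdorff (F j)).
  apply: (@le_trans _ _ (hausdorff (\big[setU/set0]_(j < n) F j))); last first.
    by apply: le_hausdorff; rewrite -(bigcup_mkord n F) => x [j _ []].
  elim: n => [|n ih]; first by rewrite !big_ord0 hausdorff_set0.
  rewrite !big_ord_recr/=.
  apply: (@le_trans _ _ (hausdorff (\big[setU/set0]_(j < n) F j) + hausdorff (F n))).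
    by rewrite leeD2r.
  case: n {ih} => [|n]; first by rewrite big_ord0 hausdorff_set0 add0e set0U.
  pose r := (t (n.*2 + b).+1%N - t (n.*2 + b).+2)%R.
  apply: (@hausdorff_metric r); first by rewrite subr_gt0 tdec'.
  move=> x y; rewrite -(bigcup_mkord n.+1 F) => -[j /= jn [_ /= /andP[xt _]]] [_ /= /andP[_ yt]].
  apply: sep; rewrite /r.
  have h1 : (t (n.*2 + b).+1 <= x ord0 i)%R.
    by apply: le_trans xt; apply: tdec; rewrite ltnS leq_add2r leq_double.
  move: yt; rewrite doubleS !addSn => yt; lra.
have Dcvg : \sum_(j <oo) hausdorff (D j) < +oo.
  have Dle b : \sum_(j <oo) hausdorff (D (j.*2 + b)%N) <= hausdorff X.
    apply: lime_le; first by apply: is_cvg_nneseries => *; exact: hausdorff_ge0.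
    by apply: nearW => n; rewrite big_mkord; exact: Dsum.
  apply: (@le_lt_trans _ _ (hausdorff X + hausdorff X)); last first.
    by apply: lte_add_pinfty; rewrite ltey.
  apply: lime_le; first by apply: is_cvg_nneseries => *; exact: hausdorff_ge0.
  apply: nearW => n.
  apply: (@le_trans _ _ (\sum_(j < n.*2) hausdorff (D j))).
    rewrite big_mkord -!(big_mkord xpredT (fun j => hausdorff (D j))).
    have nn : (n <= n.*2)%N by rewrite -addnn leq_addr.
    rewrite (big_cat_nat _ nn)//= leeDl//; apply: sume_ge0 => *; exact: hausdorff_ge0.
  have -> : \sum_(j < n.*2) hausdorff (D j) =
     \sum_(j < n) hausdorff (D (j.*2 + 0)%N) + \sum_(j < n) hausdorff (D (j.*2 + 1)%N).
    elim: n => [|n ih]; first by rewrite !big_ord0 adde0.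
    by rewrite doubleS !big_ord_recr/= ih addn0 addn1 -addeA addeACA.
  by apply: leeD; exact: Dsum.
have tail N : hausdorff (X `&` H) <= hausdorff (A N) + \sum_(N <= j <oo) hausdorff (D j).
  apply: (@le_trans _ _ (hausdorff (A N `|` \bigcup_(j in ~` `I_N) D j))).
    apply: le_hausdorff => x [Xx /= cx].
    have [xN|xN] := leP (t N) (x ord0 i); first by left.
    have [m tm] : exists m, (t m <= x ord0 i)%R.
      have xc0 : (0 < x ord0 i - c)%R by rewrite subr_gt0.
      exists (Num.trunc (x ord0 i - c)^-1).
      rewrite /t -lerBrDl -[leRHS]invrK lef_pV2 ?posrE ?invr_gt0//.
      exact/ltW/truncnS_gt.
    have exm : exists m, (t m <= x ord0 i)%R by exists m.
    right; case: (ex_minnP exm) => -[|l] tk kmin.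
      by have := le_lt_trans (le_trans (tdec 0%N N isT) tk) xN; rewrite ltxx.
    exists l; last first.
      split => //=; rewrite tk/= ltNge; apply/negP => /kmin; by rewrite ltnn.
    move=> /= kN.
    by have := le_lt_trans (le_trans (tdec _ _ kN) tk) xN; rewrite ltxx.
  apply: (le_trans (outer_measureU2 _ _ _)); rewrite leeD2l//.
  exact: outer_measure_sigma_subadditive_tail.
have : (fun N => \sum_(N <= j <oo) hausdorff (D j)) @ \oo --> 0.
  by apply: nneseries_tail_cvg => // j _; exact: hausdorff_ge0.
move=> cvg0; apply/lee_addgt0Pr => e e0.
have : \forall N \near \oo, \sum_(N <= j <oo) hausdorff (D j) <= e%:E.
  move/fine_cvgP : cvg0 => [fin /cvgrPdist_le /(_ _ e0) cv].
  near=> N.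
  rewrite -[leLHS]fineK; last by near: N.
  rewrite lee_fin; have : (`|0 - fine (\sum_(N <= j <oo) hausdorff (D j))| <= e)%R by near: N.
  by rewrite sub0r normrN; apply: le_trans; exact: ler_norm.
move=> [N _ /(_ N (leqnn N)) tN].
apply: (@le_trans _ _ (hausdorff (A N) + e%:E + hausdorff (X `&` ~` H))).
  by rewrite leeD2r// (le_trans (tail N))// leeD2l.
by rewrite addeAC leeD2r.
Unshelve. all: by end_near. Qed.

HB.instance Definition _ := isMeasure.Build rV_display 'rV[R]_d R hausdorff
  hausdorff_set0 hausdorff_ge0
  (rV_measure_sigma_additive hausdorff_halfspace).

End hausdorff.


Arguments lebesgue {R d}.
Arguments hausdorff {R d}.

(* Functions are representatives of L^2 classes: identities between elements
   of L^2 spaces hold almost everywhere on the relevant set, and values outside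
   that set are irrelevant. *)
Definition ae_on (R : realType) (d : nat)
    (mu : {measure set 'rV[R]_d -> \bar R}) (D : set 'rV[R]_d)
    (Q : 'rV[R]_d -> Prop) : Prop :=
  {ae mu, forall x, D x -> Q x}.

Section Sobolev.
Context (R : realType) (d : nat).
Implicit Types (mu : {measure set 'rV[R]_d -> \bar R}).
Implicit Types (D Omega : set 'rV[R]_d) (f g phi : 'rV[R]_d -> R).
Implicit Types (u v w : 'rV[R]_d -> 'rV[R]_d) (i : 'I_d).

Definition surface : {measure set 'rV[R]_d -> \bar R} := hausdorff d.-1.

Definition coor i v : 'rV[R]_d -> R := fun x => v x ord0 i.

Definition L2 mu D f : Prop :=
  measurable_fun D f /\ (\int[mu]_(x in D) (f x ^+ 2)%:E < +oo)%E.

Definition L2v mu D v : Prop := forall i, L2 mu D (coor i v).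

Definition L20 Omega f : Prop :=
  L2 lebesgue Omega f /\ \int[lebesgue]_(x in Omega) f x = 0.

Definition partial i f : 'rV[R]_d -> R :=
  fun x => 'D_(delta_mx ord0 i : 'rV[R]_d) f x.

Definition C1 f : Prop :=
  (forall x, differentiable f x) /\ (forall i, continuous (partial i f)).

Definition C1c Omega f : Prop :=
  C1 f /\ exists K : set 'rV[R]_d,
    [/\ compact K, K `<=` Omega & forall x, ~ K x -> f x = 0].

(* Weak first-order derivatives, tested against C^1 functions with compact
   support in Omega. *)
Definition is_wpartial Omega i f g : Prop :=
  L2 lebesgue Omega g /\
  forall phi, C1c Omega phi ->
    \int[lebesgue]_(x in Omega) (f x * partial i phi x) =
    - \int[lebesgue]_(x in Omega) (g x * phi x).

Definition wpartial Omega i f : 'rV[R]_d -> R :=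
  xget (fun=> 0) [set g | is_wpartial Omega i f g].

Definition H1 Omega f : Prop :=
  L2 lebesgue Omega f /\ forall i, exists g, is_wpartial Omega i f g.

Definition H1v Omega v : Prop := forall i, H1 Omega (coor i v).

Definition is_wdiv Omega v g : Prop :=
  L2 lebesgue Omega g /\
  forall phi, C1c Omega phi ->
    \int[lebesgue]_(x in Omega) (\sum_i v x ord0 i * partial i phi x) =
    - \int[lebesgue]_(x in Omega) (g x * phi x).

Definition wdiv Omega v : 'rV[R]_d -> R :=
  xget (fun=> 0) [set g | is_wdiv Omega v g].

Definition Hdiv Omega v : Prop :=
  L2v lebesgue Omega v /\ exists g, is_wdiv Omega v g.

Definition Hdiv_norm Omega v : R :=
  Num.sqrt (\int[lebesgue]_(x in Omega) dot (v x) (v x) +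
            \int[lebesgue]_(x in Omega) (wdiv Omega v x ^+ 2)).

Definition L2_norm Omega f : R :=
  Num.sqrt (\int[lebesgue]_(x in Omega) (f x ^+ 2)).

Definition strain Omega v (x : 'rV[R]_d) : 'M[R]_d :=
  \matrix_(i, j) ((wpartial Omega j (coor i v) x +
                   wpartial Omega i (coor j v) x) / 2).

Definition bd Omega : set 'rV[R]_d := closure Omega `\` interior Omega.

(* The trace operator is the continuous extension to H^1(Omega) of the
   restriction to the boundary of functions that are C^1 up to the boundary. *)
Definition is_trace Omega f g : Prop :=
  L2 surface (bd Omega) g /\
  exists phi : nat -> 'rV[R]_d -> R,
    [/\ forall n, C1 (phi n),
        (fun n => \int[lebesgue]_(x in Omega) ((phi n x - f x) ^+ 2)%:E)%E
          @ \oo --> 0%E,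
        forall i, (fun n => \int[lebesgue]_(x in Omega)
          ((partial i (phi n) x - wpartial Omega i f x) ^+ 2)%:E)%E
          @ \oo --> 0%E &
        (fun n => \int[surface]_(x in bd Omega) ((phi n x - g x) ^+ 2)%:E)%E
          @ \oo --> 0%E].

Definition trace Omega f : 'rV[R]_d -> R :=
  xget (fun=> 0) [set g | is_trace Omega f g].

Definition tracev Omega v : 'rV[R]_d -> 'rV[R]_d :=
  fun x => \row_i trace Omega (coor i v) x.

(* nu is the outward unit normal at a point x around which the boundary is
   flat, i.e. at almost every boundary point of a polyhedral domain. *)
Definition is_normal Omega (x nu : 'rV[R]_d) : Prop :=
  enorm nu = 1 /\ \forall y \near x, Omega y <-> dot (y - x) nu < 0.

Definition normal Omega (x : 'rV[R]_d) : 'rV[R]_d :=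
  xget 0 [set nu | is_normal Omega x nu].

(* g is the (outward) normal trace of v in H(div, Omega), when that functional
   is in L^2 of the boundary. This is the case for piecewise polynomials. *)
Definition is_ntrace Omega v g : Prop :=
  L2 surface (bd Omega) g /\
  forall phi, C1 phi ->
    \int[lebesgue]_(x in Omega)
      (wdiv Omega v x * phi x + \sum_i v x ord0 i * partial i phi x) =
    \int[surface]_(x in bd Omega) (g x * phi x).

End Sobolev.

Section Geometry.
Context (R : realType) (d : nat).
Implicit Types (Omega S : set 'rV[R]_d).

(* The vertices of a simplex are the rows of a matrix. *)
Definition affinely_independent k (a : 'M[R]_(k, d)) : Prop :=
  forall c : 'rV[R]_k, \sum_i c ord0 i = 0 -> c *m a = 0 -> c = 0.

Definition face k (a : 'M[R]_(k, d)) (I : {set 'I_k}) : set 'rV[R]_d :=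
  [set x | exists c : 'rV[R]_k,
     [/\ forall i, 0 <= c ord0 i, forall i, i \notin I -> c ord0 i = 0,
         \sum_i c ord0 i = 1 & x = c *m a]].

Definition simplex k (a : 'M[R]_(k, d)) : set 'rV[R]_d := face a [set: 'I_k]%SET.

Definition domain Omega : Prop :=
  [/\ open Omega, connected Omega & Omega !=set0].

Definition polyhedral_surface S : Prop :=
  exists F : seq 'M[R]_d,
    (forall a, a \in F -> affinely_independent a) /\
    S = \bigcup_(a in [set` F]) simplex a.

(* A Lipschitz graph over the hyperplane orthogonal to e: height e g y is
   negative below the graph, positive above it. *)
Definition height (e : 'rV[R]_d) (g : 'rV[R]_d -> R) (y : 'rV[R]_d) : R :=
  dot y e - g (y - dot y e *: e).

Definition lipschitz_fun (g : 'rV[R]_d -> R) : Prop :=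
  exists L : R, forall y z, `|g y - g z| <= L * enorm (y - z).

Definition lipschitz_boundary Omega : Prop :=
  forall x, bd Omega x -> exists e g,
    [/\ enorm e = 1, lipschitz_fun g &
        \forall y \near x, Omega y <-> height e g y < 0].

Definition lipschitz_interface Omega OmegaS OmegaD S : Prop :=
  forall x, S x -> exists e g,
    [/\ enorm e = 1, lipschitz_fun g &
        \forall y \near x, Omega y ->
          (OmegaS y <-> height e g y < 0) /\ (OmegaD y <-> 0 < height e g y)].

Definition triangulation Omega (T : seq 'M[R]_(d.+1, d)) : Prop :=
  [/\ forall a, a \in T -> affinely_independent a,
      closure Omega = \bigcup_(a in [set` T]) simplex a &
      forall a b, a \in T -> b \in T -> exists I J,
        simplex a `&` simplex b = face a I /\ face a I = face b J].

Definition piecewise_poly (T : seq 'M[R]_(d.+1, d)) (f : 'rV[R]_d -> R) : Prop :=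
  forall a, a \in T -> exists p : mpoly.mpoly d R,
    ae_on lebesgue (simplex a) (fun x => f x = mpoly.meval (x ord0) p).

Definition shape_regular (T : set 'M[R]_(d.+1, d)) : Prop :=
  exists2 c : R, 0 < c & forall a, T a -> exists x, forall y,
    enorm (y - x) <= c * fine (diameter (simplex a)) -> simplex a y.

End Geometry.

Definition finite_dimensional (R : realType) (E : lmodType R) (V : set E) : Prop :=
  exists (n : nat) (b : 'I_n -> E),
    V = [set v | exists c : 'I_n -> R, v = \sum_i c i *: b i].

Record stokes_darcy (R : realType) (d : nat) := StokesDarcy {
  Omega : set 'rV[R]_d;
  OmegaS : set 'rV[R]_d;
  OmegaD : set 'rV[R]_d;
  Sigma : set 'rV[R]_d;
  nu : R;
  kappa : 'rV[R]_d -> R;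
  Kmx : 'rV[R]_d -> 'M[R]_d;
  fS : 'rV[R]_d -> 'rV[R]_d;
  fD : 'rV[R]_d -> R }.

(* For a fixed value of h; L0S and L0D are the spaces of mean-zero pressures. *)
Record discrete_spaces (R : realType) (d : nat) := DiscreteSpaces {
  TS : seq 'M[R]_(d.+1, d);
  TD : seq 'M[R]_(d.+1, d);
  VS : set ('rV[R]_d -> 'rV[R]_d);
  L0S : set ('rV[R]_d -> R);
  HD : set ('rV[R]_d -> 'rV[R]_d);
  L0D : set ('rV[R]_d -> R) }.

Section Problem.
Context (R : realType) (d : nat) (P : stokes_darcy R d).
Implicit Types (u v : 'rV[R]_d -> 'rV[R]_d) (q phi psi : 'rV[R]_d -> R).

Definition GammaS : set 'rV[R]_d := bd (OmegaS P) `\` Sigma P.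
Definition GammaD : set 'rV[R]_d := bd (OmegaD P) `\` Sigma P.

Record admissible : Prop := Admissible {
  adm_domain : domain (Omega P);
  adm_bounded : bounded_set (Omega P);
  adm_polyhedral : polyhedral_surface (bd (Omega P));
  adm_lipschitz : lipschitz_boundary (Omega P);
  adm_domainS : domain (OmegaS P);
  adm_domainD : domain (OmegaD P);
  adm_disjoint : OmegaS P `&` OmegaD P = set0;
  adm_split : Omega P `\` Sigma P = OmegaS P `|` OmegaD P;
  adm_Sigma : Sigma P = bd (OmegaS P) `&` bd (OmegaD P);
  adm_Sigma_polyhedral : polyhedral_surface (Sigma P);
  adm_Sigma_lipschitz :
    lipschitz_interface (Omega P) (OmegaS P) (OmegaD P) (Sigma P);
  adm_nu : 0 < nu P;
  adm_kappa_measurable : measurable_fun (Sigma P) (kappa P);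
  adm_kappa : exists M : R, forall x, Sigma P x -> 0 < kappa P x <= M;
  adm_K_measurable : forall i j, measurable_fun (OmegaD P) (fun x => Kmx P x i j);
  adm_K : exists k1 k2 : R, 0 < k1 /\
    ae_on lebesgue (OmegaD P) (fun x => (Kmx P x)^T = Kmx P x /\
      forall xi : 'rV[R]_d,
        k1 * dot xi xi <= dot (Kmx P x *m xi^T)^T xi <= k2 * dot xi xi);
  adm_fS : L2v lebesgue (OmegaS P) (fS P);
  adm_fD : L20 (OmegaD P) (fD P) }.

(* The normal on Sigma points from OmegaS to OmegaD, i.e. it is outward for
   OmegaS. *)
Definition normal_Sigma (x : 'rV[R]_d) : 'rV[R]_d := normal (OmegaS P) x.

Definition fluxS u (x : 'rV[R]_d) : R :=
  dot (tracev (OmegaS P) u x) (normal_Sigma x).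

Definition tangential u (x : 'rV[R]_d) : 'rV[R]_d :=
  tracev (OmegaS P) u x - fluxS u x *: normal_Sigma x.

Definition aS u v : R :=
  2 * nu P * \int[lebesgue]_(x in OmegaS P)
    (\sum_i \sum_j strain (OmegaS P) u x i j * strain (OmegaS P) v x i j) +
  \int[surface R d]_(x in Sigma P)
    (kappa P x * dot (tangential u x) (tangential v x)).

Definition aD u v : R :=
  \int[lebesgue]_(x in OmegaD P) dot (invmx (Kmx P x) *m (u x)^T)^T (v x).

Definition bS u q : R :=
  \int[lebesgue]_(x in OmegaS P) (wdiv (OmegaS P) u x * q x).

Definition bD u q : R :=
  \int[lebesgue]_(x in OmegaD P) (wdiv (OmegaD P) u x * q x).

(* u . n = phi on Sigma and u . n = 0 on GammaD. Minus sign: n points into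
   OmegaD on Sigma, whereas g is the outward normal trace. *)
Definition fluxD u phi : Prop :=
  exists g, [/\ is_ntrace (OmegaD P) u g,
    ae_on (surface R d) GammaD (fun x => g x = 0) &
    ae_on (surface R d) (Sigma P) (fun x => - g x = phi x)].

Definition plus_constants (L : set ('rV[R]_d -> R)) : set ('rV[R]_d -> R) :=
  [set q | exists q0 (c : R), L q0 /\ q = (fun x => q0 x + c)].

Context (S : discrete_spaces R d).

Definition VhS : set ('rV[R]_d -> 'rV[R]_d) :=
  [set v | VS S v /\
    ae_on (surface R d) GammaS (fun x => tracev (OmegaS P) v x = 0)].

Definition HhD : set ('rV[R]_d -> 'rV[R]_d) :=
  [set v | HD S v /\ exists g, is_ntrace (OmegaD P) v g /\
    ae_on (surface R d) GammaD (fun x => g x = 0)].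

Definition Hh0 : set ('rV[R]_d -> 'rV[R]_d) :=
  [set v | HD S v /\ exists g, is_ntrace (OmegaD P) v g /\
    ae_on (surface R d) (bd (OmegaD P)) (fun x => g x = 0)].

Definition LhS : set ('rV[R]_d -> R) := plus_constants (L0S S).
Definition LhD : set ('rV[R]_d -> R) := plus_constants (L0D S).

Definition PhiD : set ('rV[R]_d -> R) :=
  [set phi | L2 (surface R d) (Sigma P) phi /\ exists2 v, HhD v & fluxD v phi].

Record discretization (h : R) : Prop := Discretization {
  dis_TS : triangulation (OmegaS P) (TS S);
  dis_TD : triangulation (OmegaD P) (TD S);
  dis_mesh : forall a, a \in TS S ++ TD S -> (diameter (simplex a) <= h%:E)%E;
  dis_VS_findim : finite_dimensional (VS S);
  dis_L0S_findim : finite_dimensional (L0S S);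
  dis_HD_findim : finite_dimensional (HD S);
  dis_L0D_findim : finite_dimensional (L0D S);
  dis_VS_poly : forall v, VS S v -> forall i, piecewise_poly (TS S) (coor i v);
  dis_L0S_poly : forall q, L0S S q -> piecewise_poly (TS S) q;
  dis_HD_poly : forall v, HD S v -> forall i, piecewise_poly (TD S) (coor i v);
  dis_L0D_poly : forall q, L0D S q -> piecewise_poly (TD S) q;
  dis_VS : forall v, VS S v -> H1v (OmegaS P) v;
  dis_L0S : forall q, L0S S q -> L20 (OmegaS P) q;
  dis_HD : forall v, HD S v -> Hdiv (OmegaD P) v;
  dis_L0D : forall q, L0D S q -> L20 (OmegaD P) q;
  dis_PhiD : forall psi, L2 (surface R d) (Sigma P) psi ->
    (forall a i, a \in TD S -> exists c : R,
       ae_on (surface R d) (face a [set~ i]%SET `&` Sigma P)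
         (fun x => psi x = c)) ->
    PhiD psi }.

Definition Rh (g : 'rV[R]_d -> R) : 'rV[R]_d -> R :=
  xget (fun=> 0) [set phi | PhiD phi /\ forall psi, PhiD psi ->
    \int[surface R d]_(x in Sigma P) ((g x - phi x) * psi x) = 0].

Definition Xh : set (('rV[R]_d -> 'rV[R]_d) * ('rV[R]_d -> 'rV[R]_d)) :=
  [set u | [/\ VhS u.1, HhD u.2 & fluxD u.2 (Rh (fluxS u.1))]].

Definition Qh : set (('rV[R]_d -> R) * ('rV[R]_d -> R)) :=
  [set p | LhS p.1 /\ L0D S p.2].

Definition is_flux_solution phi (w : ('rV[R]_d -> 'rV[R]_d) * ('rV[R]_d -> R)) : Prop :=
  [/\ HhD w.1 /\ L0D S w.2, fluxD w.1 phi,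
      forall v, Hh0 v -> aD w.1 v - bD v w.2 = 0 &
      forall q, L0D S q -> bD w.1 q = 0].

(* The solution (u_h^phi, p_h^phi), unique up to a.e. equality. *)
Definition flux_solution phi : ('rV[R]_d -> 'rV[R]_d) * ('rV[R]_d -> R) :=
  xget (fun=> 0, fun=> 0) [set w | is_flux_solution phi w].

Definition is_source_solution (w : ('rV[R]_d -> 'rV[R]_d) * ('rV[R]_d -> R)) : Prop :=
  [/\ Hh0 w.1 /\ L0D S w.2,
      forall v, Hh0 v -> aD w.1 v - bD v w.2 = 0 &
      forall q, L0D S q ->
        bD w.1 q = \int[lebesgue]_(x in OmegaD P) (fD P x * q x)].

(* The solution (u_h^f, p_h^f), unique up to a.e. equality. *)
Definition source_solution : ('rV[R]_d -> 'rV[R]_d) * ('rV[R]_d -> R) :=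
  xget (fun=> 0, fun=> 0) [set w | is_source_solution w].

(* The functional on PhiD that maps v . n to aD w.1 v - bD v w.2 for all v in
   HhD. *)
Definition normal_functional (w : ('rV[R]_d -> 'rV[R]_d) * ('rV[R]_d -> R)) psi : R :=
  xget 0 [set r : R | forall v, HhD v -> fluxD v psi -> r = aD w.1 v - bD v w.2].

Definition FtP phi psi : R := normal_functional (flux_solution phi) psi.
Definition gamma_f psi : R := normal_functional source_solution psi.

Definition ch u v : R := FtP (Rh (fluxS u)) (Rh (fluxS v)).

Definition lh v : R :=
  \int[lebesgue]_(x in OmegaS P) dot (fS P x) (v x) - gamma_f (Rh (fluxS v)).

Definition solves_coupled (u : ('rV[R]_d -> 'rV[R]_d) * ('rV[R]_d -> 'rV[R]_d))
    (p : ('rV[R]_d -> R) * ('rV[R]_d -> R)) : Prop :=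
  [/\ Xh u, Qh p,
      forall v : ('rV[R]_d -> 'rV[R]_d) * ('rV[R]_d -> 'rV[R]_d), Xh v ->
        aS u.1 v.1 + aD u.2 v.2 - (bS v.1 p.1 + bD v.2 p.2) =
        \int[lebesgue]_(x in OmegaS P) dot (fS P x) (v.1 x) &
      forall q : ('rV[R]_d -> R) * ('rV[R]_d -> R), Qh q ->
        bS u.1 q.1 + bD u.2 q.2 =
        \int[lebesgue]_(x in OmegaD P) (fD P x * q.2 x)].

Definition solves_reduced u (p : 'rV[R]_d -> R) : Prop :=
  [/\ VhS u, LhS p,
      forall v, VhS v -> aS u v + ch u v - bS v p = lh v &
      forall q, LhS q -> bS u q = 0].

End Problem.

(* Main.v *)
Require Import Defs.
From mathcomp Require Import all_boot all_order all_algebra.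
From mathcomp Require Import all_classical all_reals all_analysis.
From mathcomp Require Import measurable_realfun.
From mathcomp Require Import ring lra.
Import Order.TTheory GRing.Theory Num.Theory.
Import numFieldTopology.Exports numFieldNormedType.Exports.
Local Open Scope classical_set_scope.
Local Open Scope ring_scope.
Set Implicit Arguments.
Unset Strict Implicit.
Unset Printing Implicit Defensive.

(** The theorem is an elimination of the Darcy unknowns from a saddle point
problem.

For a pair w = (u, p) that satisfies the Darcy equation against all fields with
zero normal trace, the residual a(u, v) - b(v, p) depends only on the flux of v
through the interface, since two fields with the same flux differ by a field
with zero normal trace (normal_functionalE). Applied to the flux solution of phi
this residual is FtP(phi), and evaluating it on the flux solution of psi, whose
divergence is orthogonal to the pressures, gives the energy identity
FtP(phi)(psi) = a(u^phi, u^psi) (FtP_energy). Symmetry and nonnegativity then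
come from those of the form a.

In the coupled problem, testing with Darcy fields of zero normal trace shows that
(u_D, p_D) solves the Darcy equations with source f_D and flux phi
(coupled_Darcy). The sum of the source solution and of the flux solution for phi
solves the same equations (darcy_reconstruction), and the solution is unique
(saddle_injective), so the two agree. The residual of (u_D, p_D) on the flux of a
test pair is then FtP(phi) + gamma_f, which turns the coupled equation into the
reduced one. Read backwards, the same identity gives the converse.

Two ingredients need work. The flux and source solutions must exist: the
spaces are finite-dimensional, so this is the Fredholm alternative (fredholm),
with injectivity provided by the coercivity of a and by the inf-sup condition
(saddle_solvable). All functions are representatives of a.e. classes, so
injectivity means being zero a.e., and the right-hand sides have to vanish on
null representatives.

Next, the forms must be linear, although weak divergences are chosen
representatives. Uniqueness a.e. of the weak divergence is the fundamental lemma
of the calculus of variations (fundamental_lemma), proved with explicit C^1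
cutoff functions and Dynkin's theorem. Linearity of normal traces also uses that
the boundary has finite surface measure, which follows from covering each
simplex of the boundary by small pieces (hausdorff_simplex). *)

(** * Borel sets of R^d *)

Section Borel.
Context (R : realType) (d : nat).
Implicit Types (U : set 'rV[R]_d).

Lemma measurable_coord (i : 'I_d) : measurable_fun setT (fun x : 'rV[R]_d => x ord0 i).
Proof.
move=> _ B mB; apply: sub_sigma_algebra.
rewrite -bigcup_seq; exists i => /=; first by rewrite mem_index_enum.
by exists B.
Qed.

(** Centre and radius are rational so that there are countably many cubes. *)
Definition cube (q : 'rV[rat]_d * rat) : set 'rV[R]_d :=
  [set x | forall i, `|x ord0 i - ratr (q.1 ord0 i)| < ratr q.2].

Lemma measurable_cube q : measurable (cube q).
Proof.
have -> : cube q = \bigcap_(i in [set: 'I_d])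
    ((fun x : 'rV[R]_d => `|x ord0 i - ratr (q.1 ord0 i)|) @^-1` `]-oo, ratr q.2[).
  apply/seteqP; split => x /=.
    by move=> h i _; rewrite /= in_itv/=.
  by move=> h i; have := h i I; rewrite /= in_itv/=.
apply: fin_bigcap_measurable => // i _.
rewrite -[X in measurable X]setTI.
apply: (_ : measurable_fun setT _) => //.
apply: measurableT_comp => //.
by apply: measurable_funB => //; exact: measurable_coord.
Qed.

Definition ccube (q : 'rV[rat]_d * rat) : set 'rV[R]_d :=
  [set x | forall i, `|x ord0 i - ratr (q.1 ord0 i)| <= ratr q.2].

Lemma nbhs_cube U (x : 'rV[R]_d) : nbhs x U -> exists q,
  cube q x /\ ccube q `<=` U.
Proof.
move=> /nbhs_ballP[e /= e0 eU].
have [r r0 re] : exists2 r : rat, (0 : R) < ratr r & ratr r < e / 2 :> R.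
  have : (0 : R) < e / 2 by rewrite divr_gt0.
  by move=> /rat_in_itvoo[r]; rewrite in_itv/= => /andP[? ?]; exists r.
have H (i : 'I_d) : {q : rat | `|x ord0 i - ratr q| < ratr r}.
  apply: cid.
  have : x ord0 i - ratr r < x ord0 i + ratr r by lra.
  move=> /rat_in_itvoo[q]; rewrite in_itv/= => /andP[h1 h2]; exists q.
  by rewrite ltr_norml; apply/andP; split; lra.
exists (\row_i sval (H i), r); split => /= [i|y yq].
  by rewrite mxE; exact: (svalP (H i)).
apply: eU; split => // i j; rewrite ord1.
have := yq j; have := svalP (H j); rewrite mxE /ball/= => h1 h2.
rewrite -[X in `|X|](_ : (x ord0 j - ratr (sval (H j))) - (y ord0 j - ratr (sval (H j))) = _).
  apply: (le_lt_trans (ler_normB _ _)); lra.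
by ring.
Qed.

(** The sigma-algebra is generated by the coordinates, so an open set has to be
written as a countable union of products of intervals: the rational cubes that
it contains. *)
Lemma open_rV_measurable U : open U -> measurable U.
Proof.
move=> oU.
pose F n := \bigcup_(q in [set q | unpickle n = Some q /\ ccube q `<=` U]) cube q.
suff -> : U = \bigcup_n F n.
  apply: bigcupT_measurable => n; rewrite /F.
  have [[q [nq qU]]|/forallNP nU] :=
      pselect (exists q, unpickle n = Some q /\ ccube q `<=` U); last first.
    by rewrite [X in bigcup X](_ : _ = set0) ?bigcup_set0// -subset0 => q /nU.
  rewrite [X in bigcup X](_ : _ = [set q]) ?bigcup_set1; first exact: measurable_cube.
  apply/seteqP; split => [q' [] + _|_ ->//]; rewrite nq => -[] //.
apply/seteqP; split => [x Ux|x [n _ [q [_ qU] qx]]].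
  have [q [qx qU]] := nbhs_cube (open_nbhs_nbhs (conj oU Ux)).
  by exists (pickle q) => //; exists q => //; rewrite /= pickleK.
by apply: qU => i; exact/ltW/qx.
Qed.

Lemma closed_rV_measurable U : closed U -> measurable U.
Proof.
move=> cU; rewrite -[U]setCK; apply: measurableC; apply: open_rV_measurable.
exact: closed_openC.
Qed.

Lemma continuous_rV_measurable (f : 'rV[R]_d -> R) D : measurable D ->
  continuous f -> measurable_fun D f.
Proof.
move=> mD cf; apply: (@measurable_funS _ _ _ _ setT) => //.
apply: (measurability _ (RGenOpens.measurableE R)).
move=> _ [_ [a [b ->]] <-]; rewrite setTI; apply: open_rV_measurable.
by move/continuousP : cf; apply; exact: interval_open.
Qed.

End Borel.

(** * Functions of class C^1 *)

Section C1_functions.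
Context (R : realType) (d : nat).
Implicit Types (f g : 'rV[R]_d -> R).

Lemma C1_continuous f : C1 f -> continuous f.
Proof. by move=> [df _] x; exact/differentiable_continuous. Qed.

Lemma C1_cst (c : R) : C1 (fun _ : 'rV[R]_d => c).
Proof.
split=> [x|i]; first exact: differentiable_cst.
rewrite (_ : partial i _ = fun=> 0); first exact: cst_continuous.
by apply/funext => x; rewrite /partial derive_cst.
Qed.

Lemma C1_coord (j : 'I_d) : C1 (fun x : 'rV[R]_d => x ord0 j).
Proof.
split=> [x|i]; first exact: differentiable_coord.
rewrite (_ : partial i _ = fun=> (delta_mx ord0 i : 'rV[R]_d) ord0 j); first exact: cst_continuous.
apply/funext => x; apply: cvg_lim => //; apply: cvg_near_cst.
near=> h.
have h0 : h != 0 by near: h; exact: nbhs_dnbhs_neq.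
by rewrite /= !mxE addrK /GRing.scale/= mulKf.
Unshelve. all: by end_near. Qed.

Lemma C1M f g : C1 f -> C1 g -> C1 (f \* g).
Proof.
move=> [df pf] [dg pg]; split=> [x|i]; first exact: differentiableM.
rewrite (_ : partial i _ = fun x => f x * partial i g x + g x * partial i f x).
  move=> x.
  have cf : {for x, continuous f} by exact/differentiable_continuous.
  have cg : {for x, continuous g} by exact/differentiable_continuous.
  exact: cvgD (continuousM cf (pg i x)) (continuousM cg (pf i x)).
by apply/funext => x; rewrite /partial deriveM//; exact: diff_derivable.
Qed.

Lemma C1_comp (h h' : R -> R) f : (forall t : R, is_derive t 1 h (h' t)) ->
  continuous h' -> C1 f -> C1 (h \o f).
Proof.
move=> dh ch' [df pf].
have hd (t : R) : differentiable h t by apply/derivable1_diffP; case: (dh t).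
split=> [x|i]; first exact: differentiable_comp.
rewrite (_ : partial i _ = fun x => partial i f x * h' (f x)).
  move=> x; have cf : {for x, continuous f} by exact/differentiable_continuous.
  exact: continuousM (pf i x) (continuous_comp cf (ch' (f x))).
apply/funext => x; rewrite /partial deriveE; last exact: differentiable_comp.
rewrite diff_comp//= diff1E// derive1E -deriveE//.
by case: (dh (f x)) => _ ->.
Qed.

Lemma C1_prod (I : Type) (r : seq I) (F : I -> 'rV[R]_d -> R) :
  (forall i, C1 (F i)) -> C1 (fun x => \prod_(i <- r) F i x).
Proof.
move=> CF; elim: r => [|i r ih].
  by rewrite (_ : (fun _ => _) = fun=> 1); [exact: C1_cst|apply/funext => x; rewrite big_nil].
rewrite (_ : (fun _ => _) = F i \* (fun x => \prod_(j <- r) F j x)); first exact: C1M.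
by apply/funext => x; rewrite big_cons.
Qed.

End C1_functions.

Section steps.
Context (R : realType).
Implicit Types t : R.

(** The square of the positive part is C^1, vanishes exactly on the half-line
t <= 0, and is positive elsewhere; all cutoff functions are built from it. *)
Definition sqpos t : R := Num.max t 0 ^+ 2.

Lemma sqpos_ge0 t : 0 <= sqpos t. Proof. exact: sqr_ge0. Qed.

(** Away from 0 the function agrees locally with a polynomial; at 0 the
difference quotient at h is bounded by |h|. *)
Lemma is_derive_sqpos t : is_derive t 1 sqpos (2 * Num.max t 0).
Proof.
have [t0|t0|<-] := ltgtP 0 t.
- apply: (@near_eq_is_derive R R R (fun x : R => x ^+ 2)).
    near=> x; rewrite /sqpos max_l//; apply: ltW.
    by near: x; exact: lt_nbhsr.
  by apply: is_derive_eq; rewrite [_%:A]mulr1 mulr_natl.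
- apply: (@near_eq_is_derive R R R (cst 0)).
    near=> x; rewrite /sqpos max_r/= ?expr0n//; apply: ltW.
    by near: x; exact: lt_nbhsl.
  by apply: is_derive_eq; rewrite mulr0.
- have H : (fun h => h^-1 *: ((sqpos \o shift 0) (h *: 1) - sqpos 0)) @ 0^' --> (0 : R).
    apply/cvgr0Pnorm_lt => e e0; near=> h.
    rewrite /= /sqpos maxxx expr0n/= subr0 addr0 /GRing.scale/= mulr1.
    have h0 : h != 0 by near: h; exact: nbhs_dnbhs_neq.
    have he : `|h| < e by near: h; exact: dnbhs0_lt.
    rewrite normrM normfV normrX; apply: le_lt_trans he.
    have H : `|Num.max h 0| <= `|h| by case: (ltP h 0) => // _; rewrite normr0.
    rewrite ler_pdivrMl ?normr_gt0// -expr2.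
    by rewrite lerXn2r// ?nnegrE.
  rewrite mulr0; apply: DeriveDef; first by apply/cvg_ex; exists 0.
  exact: cvg_lim.
Unshelve. all: by end_near. Qed.

(** Equal to n s / (1 + n s) with s = sqpos t: a C^1 function with values in
[0, 1[ that tends to the indicator of the positive half-line. *)
Definition step n t : R := 1 - (1 + n%:R * sqpos t)^-1.

Definition step' n t : R := n%:R * (2 * Num.max t 0) / (1 + n%:R * sqpos t) ^+ 2.

Lemma step_den_gt0 n t : 0 < 1 + n%:R * sqpos t.
Proof. by rewrite ltr_wpDr// mulr_ge0// sqpos_ge0. Qed.

Lemma is_derive_step n t : is_derive t 1 (step n) (step' n t).
Proof.
have dt := is_derive_sqpos t.
have h : (cst 1 \+ n%:R \*: sqpos) t != 0 by rewrite gt_eqF//; exact: step_den_gt0.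
have dd : is_derive t 1 (cst 1 \+ n%:R \*: sqpos) (n%:R * (2 * Num.max t 0)).
  by apply: is_derive_eq; rewrite add0r.
have dV := is_deriveV h dd.
rewrite (_ : step n = cst 1 \- (fun y => ((cst 1 \+ n%:R \*: sqpos) y)^-1))//.
apply: (is_derive_eq (is_deriveB (is_derive_cst (1 : R) t 1) dV)).
by rewrite sub0r scaleNr opprK [LHS]mulrC.
Qed.

Lemma continuous_max0 : continuous (fun t => Num.max t 0 : R).
Proof. by move=> x; apply: continuous_max; [exact: cvg_id|exact: cvg_cst]. Qed.

Lemma continuous_sqpos : continuous sqpos.
Proof. by move=> t; apply: cvgM; exact: continuous_max0. Qed.

Lemma continuous_dsqpos : continuous (fun t : R => 2 * Num.max t 0).
Proof. by move=> t; apply: cvgM; [exact: cvg_cst|exact: continuous_max0]. Qed.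

Lemma continuous_step' n : continuous (step' n).
Proof.
move=> t; apply: cvgM.
  by apply: cvgM; [exact: cvg_cst|exact: continuous_dsqpos].
apply: cvgV; first by rewrite expf_neq0// gt_eqF// step_den_gt0.
by apply: cvgM; (apply: cvgD; [exact: cvg_cst|apply: cvgM; [exact: cvg_cst|exact: continuous_sqpos]]).
Qed.

Lemma step_ge0 n t : 0 <= step n t.
Proof.
by rewrite subr_ge0 invf_le1 ?step_den_gt0// lerDl mulr_ge0// sqpos_ge0.
Qed.

Lemma step_le1 n t : step n t <= 1.
Proof. by rewrite gerBl invr_ge0 ltW// step_den_gt0. Qed.

Lemma step_le0 n t : t <= 0 -> step n t = 0.
Proof.
by move=> t0; rewrite /step /sqpos max_r// expr0n/= mulr0 addr0 invr1 subrr.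
Qed.

Lemma cvg_step t : step n t @[n --> \oo] --> (((0 < t)%R)%:R : R).
Proof.
have [t0|t0] := leP t 0.
  by apply: cvg_near_cst; apply: nearW => n; rewrite step_le0.
rewrite -[X in _ --> X]subr0; apply: cvgB; first exact: cvg_cst.
apply/gtr0_cvgV0; first by apply: nearW => n; exact: step_den_gt0.
apply/cvgryPge => A.
near=> n; rewrite -lerBlDl.
have s0 : 0 < sqpos t by rewrite /sqpos max_l ?ltW// exprn_gt0.
rewrite -ler_pdivrMr//.
near: n; exact: nbhs_infty_ger.
Unshelve. all: by end_near. Qed.

End steps.

(** * Smooth approximation of orthants *)

Section orthants.
Context (R : realType) (d : nat).
Implicit Types (c : 'I_d -> \bar R) (x : 'rV[R]_d).

(** Extended-real thresholds make the orthants contain the whole space (all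
thresholds -oo) and the coordinate half-spaces, and close them under
intersection: they are the pi-system of the Dynkin argument below. *)
Definition orthant c : set 'rV[R]_d := [set x | forall i, (c i < (x ord0 i)%:E)%E].

Lemma orthantI c e : orthant c `&` orthant e = orthant (fun i => maxe (c i) (e i)).
Proof.
apply/seteqP; split => x /=.
  by move=> [h1 h2] i; rewrite gt_max h1 h2.
by move=> h; split => i; have := h i; rewrite gt_max => /andP[].
Qed.

Lemma orthantT : orthant (fun=> -oo%E) = setT.
Proof. by apply/seteqP; split => x //= _ i; rewrite ltNyr. Qed.

Lemma orthant_halfspace i (t : R) :
  orthant (fun j => if j == i then t%:E else -oo%E) = [set x | t < x ord0 i].
Proof.
apply/seteqP; split => x /=; first by move/(_ i); rewrite eqxx lte_fin.
by move=> tx j; case: eqP => [->|]; rewrite ?lte_fin// ltNyr.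
Qed.

Lemma measurable_orthant c : measurable (orthant c).
Proof.
have -> : orthant c = \bigcap_(i in [set: 'I_d])
   ((fun x => (x ord0 i)%:E) @^-1` `]c i, +oo[)%E.
  apply/seteqP; split => x /=.
    by move=> h i _; rewrite /= in_itv/= h.
  by move=> h i; have := h i I; rewrite /= in_itv/= => /andP[].
apply: fin_bigcap_measurable => // i _.
rewrite -[X in measurable X]setTI.
have mi : measurable_fun setT (fun x : 'rV[R]_d => (x ord0 i)%:E).
  by apply/measurable_EFinP; exact: measurable_coord.
by apply: mi => //; exact: emeasurable_itv.
Qed.

(** Only the inclusion from left to right needs an argument: preimages of rays
by a coordinate are orthants whose other thresholds are -oo, and such rays
generate the Borel sets of the line. *)
Lemma measurable_orthantE : @measurable _ 'rV[R]_d = <<s range orthant >>.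
Proof.
apply/seteqP; split; last first.
  apply: smallest_sub; first exact: sigma_algebra_measurable.
  by move=> _ [c _ <-]; exact: measurable_orthant.
apply: smallest_sub; first exact: smallest_sigma_algebra.
move=> B; rewrite -bigcup_seq => -[i _ [C mC <-]]; rewrite setTI.
have {}mC : (@ocitv R).-sigma.-measurable C by [].
rewrite RGenOInfty.measurableE in mC.
have [sG0 sGC sGU] := smallest_sigma_algebra setT (range orthant).
move: C mC; apply: smallest_sub => [|_ [t ->]]; last first.
  apply: sub_sigma_algebra; exists (fun j => if j == i then t%:E else -oo%E) => //.
  by rewrite orthant_halfspace; apply/seteqP; split => x; rewrite /= in_itv/= andbT.
split => [|A mA|F mF].
- by rewrite /= preimage_set0.
- by rewrite /= setTD preimage_setC -setTD; exact: sGC.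
- by rewrite /= preimage_bigcup; exact: sGU.
Qed.

Definition cut n (a : \bar R) (t : R) : R :=
  match a with EFin s => step n (t - s) | EPInf => 0 | ENInf => 1 end.

Lemma cut_ge0 n a t : 0 <= cut n a t.
Proof. by case: a => //= s; exact: step_ge0. Qed.

Lemma cut_le1 n a t : cut n a t <= 1.
Proof. by case: a => //= s; exact: step_le1. Qed.

Lemma cvg_cut a t : cut n a t @[n --> \oo] --> (((a < t%:E)%E)%:R : R).
Proof.
case: a => [s||] /=; last 2 first.
- exact: cvg_cst.
- by rewrite ltNyr; exact: cvg_cst.
by rewrite lte_fin -subr_gt0; exact: cvg_step.
Qed.

Lemma C1_affine (a s : R) (j : 'I_d) : C1 (fun x => a + s * x ord0 j).
Proof.
apply: (@C1_comp _ _ (fun t => a + s * t) (fun=> s)); last exact: C1_coord.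
- move=> t.
  rewrite (_ : (fun u => _) = cst a \+ s \*: id)//.
  by apply: is_derive_eq; rewrite add0r [s%:A]mulr1.
- exact: cst_continuous.
Qed.

Lemma C1_step n (f : 'rV[R]_d -> R) : C1 f -> C1 (fun x => step n (f x)).
Proof.
by apply: (@C1_comp _ _ (step n) (step' n)); [exact: is_derive_step|exact: continuous_step'].
Qed.

Lemma C1_cut n c j : C1 (fun x => cut n (c j) (x ord0 j)).
Proof.
case: (c j) => [s||] /=; try exact: C1_cst.
apply: C1_step.
rewrite (_ : (fun x => _) = (fun x => - s + 1 * x ord0 j)); first exact: C1_affine.
by apply/funext => x; rewrite mul1r addrC.
Qed.

Definition orthant_cut n c x : R := \prod_i cut n (c i) (x ord0 i).

Lemma C1_orthant_cut n c : C1 (orthant_cut n c).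
Proof. by apply: C1_prod => i; exact: C1_cut. Qed.

Lemma orthant_cut_ge0 n c x : 0 <= orthant_cut n c x.
Proof. by apply: prodr_ge0 => i _; exact: cut_ge0. Qed.

Lemma orthant_cut_le1 n c x : orthant_cut n c x <= 1.
Proof. by apply: prodr_ile1 => i; rewrite cut_ge0 cut_le1. Qed.

Lemma cvg_orthant_cut c x : orthant_cut n c x @[n --> \oo] --> (\1_(orthant c) x : R).
Proof.
have -> : \1_(orthant c) x =  \prod_i (((c i < (x ord0 i)%:E)%E)%:R : R).
  rewrite indicE; have [xc|xc] := pselect (orthant c x).
    by rewrite mem_set// big1// => i _; rewrite xc.
  rewrite memNset//.
  have [i xi] : exists i, ~~ (c i < (x ord0 i)%:E)%E.
    by apply/existsP; rewrite -negb_forall; apply/negP => /forallP.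
  by rewrite (bigD1 i)//= (negbTE xi) mul0r.
apply: cvg_big => [|i _]; [exact: mul_continuous|exact: cvg_cut].
Qed.

End orthants.

(** * The fundamental lemma of the calculus of variations *)

Section fundamental_lemma.
Context (R : realType) (d : nat) (mu : {measure set 'rV[R]_d -> \bar R}).
Implicit Types (Omega : set 'rV[R]_d) (g : 'rV[R]_d -> R).

(** The cutoffs tend to the indicator of the orthant, so by dominated
convergence f has integral 0 over each orthant. The measurable sets over which
f has integral 0 are closed under complement and disjoint countable union, so
by Dynkin's theorem they are all measurable sets, and f vanishes a.e. *)
Lemma ae_of_orthant_cuts Omega (f : 'rV[R]_d -> R) : measurable Omega ->
  mu.-integrable Omega (EFin \o f) ->
  (forall c n, \int[mu]_(x in Omega) (f x * orthant_cut n c x) = 0) ->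
  ae_on mu Omega (fun x => f x = 0).
Proof.
move=> mO fint f0.
have mf : measurable_fun Omega f by apply/measurable_EFinP; exact: measurable_int fint.
have fintS (E : set 'rV[R]_d) : measurable E -> mu.-integrable (Omega `&` E) (EFin \o f).
  move=> mE; apply: integrableS fint => //; exact: measurableI.
pose P (E : set 'rV[R]_d) := (\int[mu]_(x in Omega `&` E) (f x)%:E = 0)%E.
have Porthant c : P (orthant c).
  rewrite /P setIC integral_mkcondl.
  have mO' : measurable_fun Omega (EFin \o f) by exact/measurable_EFinP.
  have := @dominated_convergence _ _ _ mu Omega mO
    (fun n x => (f x * orthant_cut n c x)%:E) ((EFin \o f) \_ (orthant c))
    (abse \o (EFin \o f)) _ _ _ _ _.
  case.
  - move=> n; apply/measurable_EFinP; apply: measurable_funM => //.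
    apply: continuous_rV_measurable => //.
    exact/C1_continuous/C1_orthant_cut.
  - by apply/measurable_restrict => //; [exact: measurable_orthant|exact: measurable_funS mO'].
  - apply: aeW => x _.
    rewrite (_ : ((EFin \o f) \_ (orthant c)) x = (f x * \1_(orthant c) x)%:E); last first.
      by rewrite /patch indicE; case: ifP; rewrite ?mulr1 ?mulr0.
    apply/fine_cvgP; split; first exact: nearW.
    by apply: cvgM; [exact: cvg_cst|exact: cvg_orthant_cut].
  - exact: integrable_abse.
  - apply: aeW => x n _ /=; rewrite lee_fin normrM.
    rewrite ler_piMr// ger0_norm ?orthant_cut_ge0//; exact: orthant_cut_le1.
  move=> _ _; rewrite [X in X @ _ --> _](_ : _ = cst 0%E); last first.
    apply/funext => n /=; rewrite -[LHS]fineK; first by congr EFin; exact: f0.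
    apply: integrable_fin_num => //.
    rewrite (_ : (fun x => _) = ((EFin \o f) \* (EFin \o orthant_cut n c))%E)//.
    apply: integrableMl => //.
      by apply: continuous_rV_measurable => //; exact/C1_continuous/C1_orthant_cut.
    exists 1; split => // r r1 x _ /=; rewrite ger0_norm ?orthant_cut_ge0//.
    by rewrite (le_trans _ (ltW r1))// orthant_cut_le1.
  by move=> /cvg_lim; rewrite lim_cst// => <-.
have PE E : measurable E -> P E.
  rewrite measurable_orthantE.
  move: E; apply: (@dynkin_induction _ _ (range (@orthant R d)) P).
  - exact: measurable_orthantE.
  - by move=> _ _ [c _ <-] [e _ <-]; rewrite orthantI; exists (fun i => maxe (c i) (e i)).
  - by rewrite -(orthantT R d); exact: Porthant.
  - by move=> _ [c _ <-]; exact: Porthant.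
  - move=> S mS PS; have : P setT by rewrite -(orthantT R d); exact: Porthant.
    rewrite /P setIT -{1}(setIT Omega) -(setUCl S) setIUr integral_setU_EFin//=.
    + by rewrite PS adde0.
    + by apply: measurableI => //; exact: measurableC.
    + exact: measurableI.
    + by rewrite -setIUr setUCl setIT.
    + by apply/disj_set2P; rewrite setIACA setICl setI0.
  - move=> F mF tF PF; rewrite /P setI_bigcupr integral_bigcup.
    + by rewrite eseries0// => i _ _; exact: PF.
    + by apply: trivIset_setIl.
    + by move=> k; exact: measurableI.
    + by rewrite -setI_bigcupr; apply: fintS; exact: bigcupT_measurable.
have := @integral_ae_eq _ _ _ mu Omega mO (cst 0%E) (EFin \o f) fint (measurable_cst _).
move=> /(_ _)/filterS; apply; last first.
  by move=> E EO mE; rewrite integral_cst// mul0e -(setIidr EO); exact: PE.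
by move=> x H Ox; have [] := H Ox.
Qed.

(** Positive exactly on the open cube of q, with support in the closed one. *)
Definition cube_bump (q : 'rV[rat]_d * rat) (x : 'rV[R]_d) : R :=
  \prod_i (step 1 ((ratr q.2 - ratr (q.1 ord0 i)) + 1 * x ord0 i) *
           step 1 ((ratr (q.1 ord0 i) + ratr q.2) + (-1) * x ord0 i)).

Lemma C1_cube_bump q : C1 (cube_bump q).
Proof. by apply: C1_prod => i; apply: C1M; apply: C1_step; exact: C1_affine. Qed.

Lemma cube_bump_ge0 q x : 0 <= cube_bump q x.
Proof. by apply: prodr_ge0 => i _; rewrite mulr_ge0// step_ge0. Qed.

Lemma cube_bump_le1 q x : cube_bump q x <= 1.
Proof. by apply: prodr_ile1 => i; rewrite mulr_ge0 ?step_ge0//= mulr_ile1 ?step_ge0 ?step_le1. Qed.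

Lemma step1_gt0 (t : R) : 0 < t -> 0 < step 1 t.
Proof.
move=> t0; rewrite subr_gt0 mul1r invf_lt1 ?ltrDl; last first.
  by rewrite addr_gt0// /sqpos max_l ?ltW// exprn_gt0.
by rewrite /sqpos max_l ?ltW// exprn_gt0.
Qed.

Lemma cube_bump_neq0 q x : cube q x -> cube_bump q x != 0.
Proof.
move=> qx; rewrite gt_eqF//; apply: prodr_gt0 => i _; have := qx i.
by rewrite ltr_norml => /andP[h1 h2]; apply: mulr_gt0; apply: step1_gt0; lra.
Qed.

Lemma cube_bump_eq0 q x : ~ ccube q x -> cube_bump q x = 0.
Proof.
move=> /existsNP[i]/negP; rewrite -ltNge => h.
rewrite /cube_bump (bigD1 i)//=.
suff -> : step 1 (ratr q.2 - ratr (q.1 ord0 i) + 1 * x ord0 i) *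
  step 1 (ratr (q.1 ord0 i) + ratr q.2 + -1 * x ord0 i) = 0 by rewrite mul0r.
have [xq|xq] := leP (x ord0 i) (ratr (q.1 ord0 i)).
  rewrite [X in X * _]step_le0 ?mul0r//.
  by move: h; rewrite ler0_norm ?subr_le0//; lra.
rewrite [X in _ * X]step_le0 ?mulr0//.
by move: h; rewrite ger0_norm; [lra|rewrite subr_ge0 ltW].
Qed.

Lemma compact_ccube q : compact (@ccube R d q).
Proof.
pose I (i : 'I_d) : set R :=
  `[(ratr (q.1 ord0 i) - ratr q.2), (ratr (q.1 ord0 i) + ratr q.2)]%classic.
rewrite (_ : ccube q = [set v : 'rV[R]_d | forall i, I i (v ord0 i)]).
  by apply: rV_compact => i; exact: segment_compact.
apply/seteqP; split => x /= h i; have := h i; rewrite /I /= in_itv/= ler_norml => /andP[h1 h2].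
  by apply/andP; split; lra.
by apply/andP; split; lra.
Qed.

(** Test with the product of a bump on a small cube and an orthant cutoff: the
product of g and the bump then vanishes a.e., hence g vanishes a.e. on the open
cube. Countably many such cubes cover Omega. *)
Lemma fundamental_lemma Omega g : open Omega ->
  mu.-integrable Omega (EFin \o g) ->
  (forall phi, C1c Omega phi -> \int[mu]_(x in Omega) (g x * phi x) = 0) ->
  ae_on mu Omega (fun x => g x = 0).
Proof.
move=> oO gint g0; have mO := open_rV_measurable oO.
have H (q : 'rV[rat]_d * rat) : ccube q `<=` Omega ->
    ae_on mu Omega (fun x => g x * cube_bump q x = 0).
  move=> qO; apply: ae_of_orthant_cuts => //.
    rewrite (_ : EFin \o _ = ((EFin \o g) \* (EFin \o cube_bump q))%E)//.
    apply: integrableMl => //.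
      by apply: continuous_rV_measurable => //; exact/C1_continuous/C1_cube_bump.
    exists 1; split => // r r1 x _ /=; rewrite ger0_norm ?cube_bump_ge0//.
    by rewrite (le_trans _ (ltW r1))// cube_bump_le1.
  (* The bump makes the orthant cutoff compactly supported in Omega. *)
  move=> c n; rewrite -[RHS](g0 (cube_bump q \* orthant_cut n c)).
    by apply: eq_Rintegral => x _; rewrite mulrA.
  split; first by apply: C1M; [exact: C1_cube_bump|exact: C1_orthant_cut].
  exists (ccube q); split => //; first exact: compact_ccube.
  by move=> x /cube_bump_eq0 /= ->; rewrite mul0r.
have : {ae mu, forall x (k : nat), forall q, unpickle k = Some q -> ccube q `<=` Omega ->
    Omega x -> g x * cube_bump q x = 0}.
  apply: ae_foralln => k.
  case: (pselect (exists q, unpickle k = Some q /\ @ccube R d q `<=` Omega)) => [[q [kq qO]]|/forallNP N].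
    have := H q qO; rewrite /ae_on; apply: filterS => x h q'; rewrite kq => -[<-] _; exact: h.
  by apply: aeW => x q kq qO; have [] := N q.
apply: filterS => x h Ox.
have [q [qx qO]] := nbhs_cube (open_nbhs_nbhs (conj oO Ox)).
have := h (pickle q) q (pickleK _) qO Ox => /eqP; rewrite mulf_eq0.
by rewrite (negbTE (cube_bump_neq0 qx)) orbF => /eqP.
Qed.

End fundamental_lemma.

(** * Finite-dimensional linear algebra *)

Section finite_dimension.
Context (R : realType).

Definition subspace_of (E : lmodType R) (W : set E) : Prop :=
  W 0 /\ forall (s : R) x y, W x -> W y -> W (s *: x + y).

(** Linearity on W only: the Darcy forms involve weak divergences and
integrals, which need not be additive on arbitrary functions. *)
Definition linear_on (E : lmodType R) (W : set E) (f : E -> R) : Prop :=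
  forall (s : R) x y, W x -> W y -> f (s *: x + y) = s * f x + f y.

Lemma subspace_sum (E : lmodType R) (W : set E) n (c : 'I_n -> R) (b : 'I_n -> E) :
  subspace_of W -> (forall i, W (b i)) -> W (\sum_i c i *: b i).
Proof.
move=> [W0 WD] Wb; elim/big_rec : _ => // i x _ Wx.
exact: WD.
Qed.

Lemma linear_on0 (E : lmodType R) (W : set E) f :
  subspace_of W -> linear_on W f -> f 0 = 0.
Proof.
move=> [W0 _] lf; have := lf 1 0 0 W0 W0; rewrite scale1r add0r mul1r => h; lra.
Qed.

Lemma linear_on_sum (E : lmodType R) (W : set E) n (c : 'I_n -> R) (b : 'I_n -> E) f :
  subspace_of W -> linear_on W f -> (forall i, W (b i)) ->
  f (\sum_i c i *: b i) = \sum_i c i * f (b i).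
Proof.
move=> sW lf Wb; have f0 := linear_on0 sW lf; have [W0 WD] := sW.
suff [] : W (\sum_i c i *: b i) /\ f (\sum_i c i *: b i) = \sum_i c i * f (b i) by [].
elim/big_rec2 : _ => // i y x _ [Wx fx]; split; first exact: WD.
by rewrite lf// fx.
Qed.

(** Take M of maximal rank among the matrices whose rows lie in U: adding to M
a row of U outside its row space would increase the rank. *)
Lemma subspace_rowspace n (U : set 'rV[R]_n) : subspace_of U ->
  exists M : 'M[R]_n, forall c, U c <-> (c <= M)%MS.
Proof.
move=> sU; have [U0 UD] := sU.
pose good r := `[< exists M : 'M[R]_n, \rank M = r /\ forall c, (c <= M)%MS -> U c >].
have exr : exists r, good r.
  exists 0%N; apply/asboolP; exists 0; split; first by rewrite mxrank0.
  by move=> c; rewrite submx0 => /eqP ->.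
have ler r : good r -> (r <= n)%N.
  by move=> /asboolP[M [<- _]]; exact: rank_leq_row.
case: (ex_maxnP exr ler) => r /asboolP[M [rM MU]] rmax.
exists M => c; split=> [Uc|]; last exact: MU.
(* By maximality of the rank it is enough that the row space of M + c lies in U. *)
have : good (\rank (M + c)%MS).
  apply/asboolP; exists (M + c)%MS; split => // v /sub_addsmxP[[y1 y2] /= ->].
  rewrite addrC (_ : y2 *m c = y2 ord0 ord0 *: c); last first.
    by rewrite [y2]mx11_scalar mul_scalar_mx !mxE.
  by apply: UD => //; apply: MU; exact: submxMl.
move=> /rmax; rewrite -rM => le.
have : (M + c <= M)%MS by rewrite -(geq_leqif (mxrank_leqif_sup (addsmxSl M c))).
by move=> /(submx_trans _); apply; exact: addsmxSr.
Qed.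

(** The family b that spans V need not be free, so the argument goes through
the space of coefficient vectors of elements of W. *)
Lemma finite_dimensional_subspace (E : lmodType R) (V W : set E) :
  finite_dimensional V -> W `<=` V -> subspace_of W -> finite_dimensional W.
Proof.
move=> [n [b Vb]] WV sW; have [W0 WD] := sW.
pose comb (c : 'rV[R]_n) := \sum_i c ord0 i *: b i.
have combD (s : R) c e : comb (s *: c + e) = s *: comb c + comb e.
  rewrite /comb scaler_sumr -big_split; apply: eq_bigr => i _ /=.
  by rewrite !mxE scalerDl scalerA.
have [|M UM] := @subspace_rowspace n [set c | W (comb c)].
  split => /=; last by move=> s x y Wx Wy; rewrite combD; exact: WD.
  by rewrite /comb big1// => i _; rewrite mxE scale0r.
exists n, (fun i => comb (row i M)); apply/seteqP; split => x.
  move=> Wx; have := WV _ Wx; rewrite Vb => -[c xc].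
  have xE : x = comb (\row_i c i).
    by rewrite xc; apply: eq_bigr => i _; rewrite mxE.
  have /UM/submxP[D DM] : [set c | W (comb c)] (\row_i c i) by rewrite /= -xE.
  exists (fun i => D ord0 i); rewrite xE DM /comb.
  under [RHS]eq_bigr do rewrite scaler_sumr.
  rewrite exchange_big; apply: eq_bigr => j _ /=.
  by rewrite mxE scaler_suml; apply: eq_bigr => i _; rewrite mxE scalerA.
move=> [c ->]; apply: subspace_sum => // i.
by apply/(UM (row i M)); exact: row_sub.
Qed.

Lemma subspace_finite_dimensional (E : lmodType R) (V : set E) :
  finite_dimensional V -> subspace_of V.
Proof.
move=> [n [b ->]]; split.
  by exists (fun=> 0); rewrite big1// => i _; rewrite scale0r.
move=> s _ _ [c ->] [e ->]; exists (fun i => s * c i + e i).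
rewrite scaler_sumr -big_split; apply: eq_bigr => i _ /=.
by rewrite scalerDl scalerA.
Qed.

Lemma finite_dimensional_prod (E F : lmodType R) (V : set E) (Q : set F) :
  finite_dimensional V -> finite_dimensional Q ->
  finite_dimensional (V `*` Q : set (E * F)%type).
Proof.
move=> [n [b ->]] [m [e ->]].
exists (n + m)%N, (fun i => match fintype.split i with inl j => (b j, 0) | inr k => (0, e k) end).
have sumE (c : 'I_(n + m) -> R) :
    \sum_i c i *: (match fintype.split i with inl j => (b j, 0) | inr k => (0, e k) end : E * F) =
    (\sum_j c (lshift m j) *: b j, \sum_k c (rshift n k) *: e k).
  rewrite big_split_ord /=.
  under eq_bigr => i _ do rewrite (unsplitK (inl i : 'I_n + 'I_m)) .
  under [X in _ + X]eq_bigr => i _ do rewrite (unsplitK (inr i : 'I_n + 'I_m)).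
  apply/eqP; rewrite -pair_eqE /= !raddf_sum /= [X in _ + X]big1 ?addr0; last by move=> i _; rewrite scaler0.
  by rewrite [X in X + _]big1 ?add0r ?eqxx// => i _; rewrite scaler0.
apply/seteqP; split => [[x y] [/= [c ->] [c' ->]]|_ [c ->]].
  exists (fun i => match fintype.split i with inl j => c j | inr k => c' k end).
  rewrite sumE; congr (_, _); apply: eq_bigr => i _.
    by rewrite (unsplitK (inl i : 'I_n + 'I_m)).
  by rewrite (unsplitK (inr i : 'I_n + 'I_m)).
by rewrite sumE; split; [exists (fun j => c (lshift m j))|exists (fun k => c (rshift n k))].
Qed.

(** Fredholm alternative. The kernel condition allows T to be degenerate, which
matters because discrete functions are representatives and may differ on null
sets: the Darcy saddle point form is injective only up to a.e. equality. *)
Lemma fredholm (E : lmodType R) (W : set E) (T : E -> E -> R) (l : E -> R) :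
  finite_dimensional W -> subspace_of W ->
  (forall z, W z -> linear_on W (T z)) ->
  (forall z, W z -> linear_on W (T ^~ z)) ->
  linear_on W l ->
  (forall z, W z -> (forall w, W w -> T w z = 0) -> l z = 0) ->
  exists2 z, W z & forall w, W w -> T z w = l w.
Proof.
move=> [n [b Wb]] sW lT lT' ll ker.
have Wbi i : W (b i).
  rewrite Wb; exists (fun j => (j == i)%:R).
  by rewrite (bigD1 i)//= eqxx scale1r big1 ?addr0// => j /negbTE ->; rewrite scale0r.
pose A := \matrix_(i, j) T (b i) (b j).
pose c : 'rV[R]_n := \row_j l (b j).
have /submxP[y cy] : (c <= A)%MS.
  rewrite submxE; apply/eqP; apply/rowP => k; rewrite !mxE.
  have := mulmx_coker A => /matrixP AK.
  pose z := \sum_j cokermx A j k *: b j.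
  have Wz : W z by exact: subspace_sum.
  have : l z = 0.
    apply: ker => // w; rewrite Wb => -[e ->].
    rewrite (linear_on_sum _ sW (lT' z Wz))// big1// => i _.
    rewrite (linear_on_sum _ sW (lT (b i) (Wbi i)))//.
    have := AK i k; rewrite !mxE => h; rewrite -[RHS](mulr0 (e i)); congr (_ * _); rewrite -[RHS]h.
    by apply: eq_bigr => j _; rewrite [A i j]mxE mulrC.
  rewrite (linear_on_sum _ sW ll)// => h; rewrite -[RHS]h.
  by apply: eq_bigr => j _; rewrite [c _ _]mxE mulrC.
exists (\sum_i y ord0 i *: b i); first exact: subspace_sum.
move=> w; rewrite Wb => -[e ->].
have Wy : W (\sum_i y ord0 i *: b i) by exact: subspace_sum.
rewrite (linear_on_sum _ sW (lT _ Wy))// (linear_on_sum _ sW ll)//.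
apply: eq_bigr => j _; congr (_ * _).
rewrite (linear_on_sum _ sW (lT' _ (Wbi j)))//.
have /rowP/(_ j) := cy; rewrite !mxE => ->.
by apply: eq_bigr => i _; rewrite mxE.
Qed.

End finite_dimension.

(** * Finiteness of the surface measure of a simplex *)

Section finite_covers.
Context (R : realType) (T I : Type) (P : set I) (E : I -> set T) (w : I -> \bar R).

Lemma cover_measure_le_sum (J : finType) (F : J -> I) (A : set T) :
  (forall j, P (F j)) -> A `<=` \bigcup_j E (F j) ->
  (cover_measure P E w A <= \sum_j w (F j))%E.
Proof.
move=> PF AF.
pose s k := omap (F \o enum_val) (insub k : option 'I_#|J|).
have sE (j : 'I_#|J|) : s j = Some (F (enum_val j)) by rewrite /s valK.
have sN k : (#|J| <= k)%N -> s k = None by move=> Jk; rewrite /s insubF// ltnNge Jk.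
apply: ereal_inf_lbound; exists s.
  split=> [k i|x /AF[j _ xj]].
    by rewrite /s; case: insubP => //= u _ _ [<-].
  by exists (enum_rank j) => //; rewrite sE enum_rankK.
apply: cvg_lim => //; apply: cvg_near_cst; near=> n.
have Jn : (#|J| <= n)%N by near: n; exact: nbhs_infty_ge.
rewrite (big_cat_nat (n := #|J|))//= [X in (_ + X)%E]big1_seq ?adde0; last first.
  by move=> k; rewrite mem_index_iota => /andP[_ /andP[Jk _]]; rewrite sN.
rewrite big_mkord (eq_bigr (fun j : 'I_#|J| => w (F (enum_val j)))); last first.
  by move=> j _; rewrite sE.
by rewrite -(big_enum_val (fun j => w (F j))); apply: eq_bigl.
Unshelve. all: by end_near. Qed.

End finite_covers.

Section hausdorff_simplex.
Context (R : realType) (d k : nat).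
Implicit Types (a : 'M[R]_(k.+1, d)) (c : 'rV[R]_k.+1).

Lemma enorm_le_sum (x : 'rV[R]_d) : enorm x <= \sum_j `|x ord0 j|.
Proof.
have S0 (r : seq 'I_d) : 0 <= \sum_(j <- r) `|x ord0 j| by exact: sumr_ge0.
rewrite /enorm -[leRHS]ger0_norm// -sqrtr_sqr ler_wsqrtr// /dot.
elim: (index_enum _) => [|j r ih]; first by rewrite !big_nil expr0n.
rewrite !big_cons sqrrD -addrA lerD//; first by rewrite -normrX ger0_norm ?sqr_ge0// expr2.
by rewrite (le_trans ih)// lerDr mulrn_wge0// mulr_ge0.
Qed.

(** Each barycentric coordinate except the first lies in a given interval of
length 1/(n+1). Leaving one coordinate free is what
makes the number of pieces (n+1)^k rather than (n+1)^(k+1). *)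
Definition piece a n (f : {ffun 'I_k -> 'I_n.+1}) : set 'rV[R]_d :=
  [set x | exists c, [/\ forall i, (f i)%:R <= n.+1%:R * c ord0 (lift ord0 i) <= (f i)%:R + 1,
     \sum_i c ord0 i = 1 & x = c *m a]].

Lemma simplex_pieces a n : simplex a `<=` \bigcup_f (@piece a n f).
Proof.
move=> x [c [c0 _ c1 ->]].
have ci i : c ord0 i <= 1.
  by rewrite -c1 (bigD1 i)//= lerDl sumr_ge0.
(* The truncation equals n + 1 when the coordinate is 1; the minimum puts that
   case in the last interval. *)
exists [ffun i => inord (minn (Num.truncn (n.+1%:R * c ord0 (lift ord0 i))) n) : 'I_n.+1] => //.
exists c; split => // i; rewrite ffunE inordK ?ltnS ?geq_minr//.
set t := _ * _.
have t0 : 0 <= t by rewrite mulr_ge0.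
have tn : t <= n%:R + 1 by rewrite natr1 ler_piMr.
have /andP[h1 h2] := truncn_itv t0.
apply/andP; split; first by rewrite (le_trans _ h1)// ler_nat geq_minl.
by rewrite /minn; case: ltnP => // _; rewrite natr1 ltW.
Qed.

(** A constant such that every piece of order n has diameter at most
piece_constant a / (n+1). *)
Definition piece_constant a : R := k.+1%:R * \sum_j \sum_i `|a i j|.

Lemma piece_constant_ge0 a : 0 <= piece_constant a.
Proof. by rewrite mulr_ge0// sumr_ge0// => j _; rewrite sumr_ge0. Qed.

Lemma diameter_piece a n (f : {ffun 'I_k -> 'I_n.+1}) :
  (diameter (piece a f) <= (piece_constant a / n.+1%:R)%:E)%E.
Proof.
apply: ge_ereal_sup => _ [->|[_ [c [cf c1 ->]] [_ [e [ef e1 ->]] <-]]].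
  by rewrite lee_fin divr_ge0// piece_constant_ge0.
rewrite lee_fin -mulmxBl; apply: (le_trans (enorm_le_sum _)).
have n0 : 0 < n.+1%:R :> R by [].
have H i : `|(c - e) ord0 (lift ord0 i)| <= n.+1%:R^-1.
  have /andP[h1 h2] := ef i; have /andP[h3 h4] := cf i.
  rewrite !mxE -(ler_pM2l n0) mulfV ?gt_eqF// -{1}(ger0_norm (ltW n0)) -normrM mulrBr.
  by rewrite ler_norml; apply/andP; split; lra.
have H' i : `|(c - e) ord0 i| <= k.+1%:R / n.+1%:R.
  have [j ->|->] := unliftP ord0 i.
    by apply: (le_trans (H j)); rewrite -[leLHS]mul1r ler_wpM2r// ?ler1n// invr_ge0 ltW.
  (* Both coordinate vectors have sum 1, which bounds the free coordinate. *)
  rewrite (_ : (c - e) ord0 ord0 = - \sum_(j < k) (c - e) ord0 (lift ord0 j)); last first.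
    have : \sum_j (c - e) ord0 j = 0.
      under eq_bigr do rewrite !mxE.
      by rewrite sumrB c1 e1 subrr.
    by rewrite big_ord_recl => /eqP; rewrite addr_eq0 => /eqP.
  rewrite normrN; apply: (le_trans (ler_norm_sum _ _ _)).
  apply: (@le_trans _ _ (\sum_(j < k) n.+1%:R^-1)); first by apply: ler_sum => j _; exact: H.
  by rewrite sumr_const card_ord -[leLHS]mulr_natl ler_wpM2r ?ler_nat// invr_ge0 ltW.
rewrite /piece_constant mulrAC mulr_sumr; apply: ler_sum => j _; rewrite mulr_sumr mxE.
apply: (le_trans (ler_norm_sum _ _ _)); apply: ler_sum => i _.
by rewrite normrM ler_wpM2r.
Qed.

(** There are (n+1)^k pieces, each of diameter O(1/n), so the total weight in
dimension k stays bounded as n grows. *)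
Lemma hausdorff_simplex a : (hausdorff k (simplex a) < +oo)%E.
Proof.
pose W : R := fine (lebesgue [set x : 'rV[R]_k | enorm x <= 1]) / 2 ^+ k.
have W0 : 0 <= W by rewrite divr_ge0 ?exprn_ge0// fine_ge0//; exact: outer_measure_ge0.
have wE (A : set 'rV[R]_d) : hausdorff_weight k A = (W%:E * diameter A ^+ k)%E by [].
clearbody W.
apply: (@le_lt_trans _ _ (W * piece_constant a ^+ k)%:E); last exact: ltry.
apply: ge_ereal_sup => _ [delta /= delta0 <-].
have [n an] : exists n, piece_constant a / n.+1%:R <= delta.
  exists (Num.truncn (piece_constant a / delta)).
  rewrite ler_pdivrMr// mulrC -ler_pdivrMr//; exact/ltW/truncnS_gt.
apply: (le_trans (@cover_measure_le_sum R _ _ [set A : set 'rV[R]_d | diameter A <= delta%:E]%E id (hausdorff_weight k)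
   {ffun 'I_k -> 'I_n.+1} (@piece a n) _ _ _)).
- by move=> f /=; rewrite (le_trans (diameter_piece a f))// lee_fin.
- exact: simplex_pieces.
apply: (@le_trans _ _ (\sum_(f : {ffun 'I_k -> 'I_n.+1}) (W * (piece_constant a / n.+1%:R) ^+ k)%:E)%E).
  apply: lee_sum => f _; rewrite wE EFinM lee_wpmul2l ?lee_fin//.
  rewrite EFin_expe.
  have := diameter_piece a f; have := diameter_ge0 (piece a f).
  move: (diameter _) (piece_constant a / _) => y z h0 h1.
  elim: {1 2}k => [|m ih]; first by rewrite !expe0.
  by rewrite !expeS lee_pmul//; exact: expe_ge0.
rewrite sumEFin lee_fin sumr_const card_ffun !card_ord -[leLHS]mulr_natl natrX.
by rewrite mulrCA -exprMn mulrCA mulfV ?mulr1.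
Qed.

End hausdorff_simplex.

(** * Square-integrable functions on bounded domains *)

Section square_integrable.
Context (R : realType) (d : nat) (mu : {measure set 'rV[R]_d -> \bar R}).
Context (D : set 'rV[R]_d) (mD : measurable D).
Implicit Types (f g h : 'rV[R]_d -> R).

Lemma L2_integrable_sqr f : L2 mu D f -> mu.-integrable D (fun x => (f x ^+ 2)%:E).
Proof.
move=> [mf ff]; apply/integrableP; split.
  by apply/measurable_EFinP; exact: measurable_funX.
rewrite (eq_integral (fun x => (f x ^+ 2)%:E))// => x _.
by rewrite gee0_abs// lee_fin sqr_ge0.
Qed.

Lemma L2M_integrable f g : L2 mu D f -> L2 mu D g ->
  mu.-integrable D (EFin \o (fun x => f x * g x)).
Proof.
move=> Lf Lg; have [mf _] := Lf; have [mg _] := Lg.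
apply: (@le_integrable _ _ _ mu D mD _ (fun x => (f x ^+ 2)%:E + (g x ^+ 2)%:E)%E).
- by apply/measurable_EFinP; exact: measurable_funM.
- move=> x _ /=; rewrite lee_fin [leRHS]ger0_norm; last by rewrite addr_ge0 ?sqr_ge0.
  rewrite ler_norml; apply/andP; split; nra.
- by apply: integrableD => //; exact: L2_integrable_sqr.
Qed.

Lemma L2_lin (s : R) f g : L2 mu D f -> L2 mu D g -> L2 mu D (fun x => s * f x + g x).
Proof.
move=> Lf Lg; have [mf _] := Lf; have [mg _] := Lg; split.
  by apply: measurable_funD => //; exact: measurable_funM.
have : mu.-integrable D (fun x => (2 * s ^+ 2)%:E * (f x ^+ 2)%:E + 2%:E * (g x ^+ 2)%:E)%E.
  by apply: integrableD => //; apply: integrableZl => //; exact: L2_integrable_sqr.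
move=> /(integrable_lty mD); apply: le_lt_trans.
apply: ge0_le_integral => //.
- by move=> x _; rewrite lee_fin sqr_ge0.
- apply/measurable_EFinP; apply: measurable_funX.
  by apply: measurable_funD => //; exact: measurable_funM.
- apply: emeasurable_funD; apply/measurable_EFinP; apply: measurable_funM => //; exact: measurable_funX.
- move=> x _; rewrite -!EFinM -EFinD lee_fin.
  have := sqr_ge0 (s * f x - g x); nra.
Qed.

Lemma L2_0 : L2 mu D (fun=> 0).
Proof.
split; first exact: measurable_cst.
by rewrite (eq_integral (cst 0%E)) ?integral0 ?ltry// => x _; rewrite expr0n.
Qed.

Lemma Rintegral_lin (s : R) f g h :
  mu.-integrable D (EFin \o f) -> mu.-integrable D (EFin \o g) ->
  {in D, forall x, h x = s * f x + g x} ->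
  \int[mu]_(x in D) h x = s * \int[mu]_(x in D) f x + \int[mu]_(x in D) g x.
Proof.
move=> fi gi hE.
have sfi : mu.-integrable D (EFin \o (fun x => s * f x)).
  by rewrite (_ : _ \o _ = (fun x => s%:E * (EFin \o f) x)%E)//; exact: integrableZl.
by rewrite (eq_Rintegral _ hE) RintegralD// RintegralZl.
Qed.

Lemma Rintegral_sqr_eq0 f : L2 mu D f -> \int[mu]_(x in D) (f x ^+ 2) = 0 ->
  ae_on mu D (fun x => f x = 0).
Proof.
move=> Lf f0; have [mf _] := Lf.
have mf2 : measurable_fun D (fun x => (f x ^+ 2)%:E).
  by apply/measurable_EFinP; exact: measurable_funX.
have : (\int[mu]_(x in D) `|(f x ^+ 2)%:E| = 0)%E.
  rewrite (eq_integral (fun x => (f x ^+ 2)%:E)); last first.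
    by move=> x _; rewrite gee0_abs// lee_fin sqr_ge0.
  rewrite -[LHS]fineK; first by congr EFin.
  by apply: integrable_fin_num => //; exact: L2_integrable_sqr.
move=> /ae_eq_integral_abs => /(_ mD mf2); rewrite /ae_on; apply: filterS => x H Dx.
by have := H Dx => -[]/eqP; rewrite sqrf_eq0 => /eqP.
Qed.

Lemma ae_eq_Rintegral f g : measurable_fun D f -> measurable_fun D g ->
  ae_on mu D (fun x => f x = g x) ->
  \int[mu]_(x in D) f x = \int[mu]_(x in D) g x.
Proof.
move=> mf mg fg; congr fine; apply: ae_eq_integral => //.
- exact/measurable_EFinP.
- exact/measurable_EFinP.
- by move: fg; rewrite /ae_on; apply: filterS => x H Dx; rewrite H.
Qed.

Lemma Rintegral_ae_eq0 f g : measurable_fun D f -> measurable_fun D g ->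
  ae_on mu D (fun x => f x = 0) -> \int[mu]_(x in D) (f x * g x) = 0.
Proof.
move=> mf mg f0; rewrite (@ae_eq_Rintegral _ (fun=> 0)).
- by rewrite Rintegral_cst// mul0r.
- exact: measurable_funM.
- exact: measurable_cst.
- by move: f0; rewrite /ae_on; apply: filterS => x H Dx; rewrite H// mul0r.
Qed.

Lemma continuous_L2 f (B : set 'rV[R]_d) : continuous f -> compact B -> D `<=` B ->
  (mu D < +oo)%E -> L2 mu D f.
Proof.
move=> cf cB DB Dfin.
have mf : measurable_fun D f by exact: continuous_rV_measurable.
split => //.
have [M [Mr MB]] : bounded_set (f @` B).
  by apply: compact_bounded; apply: continuous_compact => //; exact: continuous_subspaceT.
have fM x : D x -> `|f x| <= M + 1.
  by move=> Dx; apply: (MB (M + 1)); [rewrite ltrDl|exists x => //; exact: DB].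
apply: (@le_lt_trans _ _ (\int[mu]_(x in D) ((M + 1) ^+ 2)%:E)%E).
  apply: ge0_le_integral => //.
  - by move=> x _; rewrite lee_fin sqr_ge0.
  - by apply/measurable_EFinP; exact: measurable_funX.
  - move=> x Dx; rewrite lee_fin -[_ ^+ 2]ger0_norm ?sqr_ge0// normrX.
    by rewrite lerXn2r ?nnegrE// ?fM// (le_trans _ (fM x Dx)).
by rewrite integral_cst// lte_mul_pinfty// lee_fin sqr_ge0.
Qed.

End square_integrable.

Section bounded_domains.
Context (R : realType) (d : nat).
Implicit Types (Omega : set 'rV[R]_d).

Definition sup_ball (M : R) : set 'rV[R]_d := [set x | forall i, - M <= x ord0 i <= M].

Lemma compact_sup_ball M : compact (sup_ball M).
Proof.
pose I (i : 'I_d) : set R := `[(- M), M]%classic.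
rewrite (_ : sup_ball M = [set v : 'rV[R]_d | forall i, I i (v ord0 i)]).
  by apply: rV_compact => i; exact: segment_compact.
by apply/seteqP; split => x /= h i; have := h i; rewrite /I /= in_itv.
Qed.

Lemma bounded_sup_ball Omega : bounded_set Omega -> exists2 M, 0 <= M & Omega `<=` sup_ball M.
Proof.
move=> [M [Mr MO]]; exists (`|M| + 1); first by rewrite addr_ge0.
move=> x Ox i; rewrite -ler_norml.
have : `|x| <= `|M| + 1.
  by apply: MO => //; rewrite (le_lt_trans (ler_norm M))// ltrDl.
apply: le_trans; rewrite [leRHS]/Num.Def.normr /= mx_normrE.
by apply/bigmax_geP; right => /=; exists (ord0, i).
Qed.

Lemma lebesgue_sup_ball M : 0 <= M -> (lebesgue (sup_ball M) < +oo)%E.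
Proof.
move=> M0; pose ab : 'rV[R]_d * 'rV[R]_d := (const_mx (- M), const_mx M).
apply: (@le_lt_trans _ _ (\sum_(j < 1) box_volume ab)%E); last by rewrite big_ord1 ltry.
apply: (@cover_measure_le_sum _ _ _ _ _ (@box_volume R d) _ (fun=> ab)).
  by move=> _ i /=; rewrite !mxE; lra.
by move=> x xM; exists ord0 => // i; rewrite /= !mxE.
Qed.

Lemma bounded_lebesgue Omega : measurable Omega -> bounded_set Omega -> (lebesgue Omega < +oo)%E.
Proof.
move=> mO /bounded_sup_ball[M M0 OM].
apply: le_lt_trans (lebesgue_sup_ball M0); exact: le_outer_measure.
Qed.

End bounded_domains.

(** * Weak divergence and normal trace *)

Lemma integrable_sumR (R : realType) (d : nat) (mu : {measure set 'rV[R]_d -> \bar R})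
    (D : set 'rV[R]_d) (n : nat) (h : 'I_n -> 'rV[R]_d -> R) : measurable D ->
  (forall i, mu.-integrable D (EFin \o h i)) ->
  mu.-integrable D (EFin \o (fun x => \sum_i h i x)).
Proof.
move=> mD ih; rewrite (_ : _ \o _ = (fun x => \sum_i (EFin \o h i) x)%E).
  exact: integrable_sum.
by apply/funext => x /=; rewrite sumEFin.
Qed.

Section weak_divergence.
Context (R : realType) (d : nat) (Omega : set 'rV[R]_d).
Context (oO : open Omega) (bO : bounded_set Omega).
Implicit Types (u v : 'rV[R]_d -> 'rV[R]_d) (phi g h : 'rV[R]_d -> R).

Let mO : measurable Omega. Proof. exact: open_rV_measurable. Qed.

Lemma closure_sup_ball : exists B, compact B /\ closure Omega `<=` B.
Proof.
have [M _ OM] := bounded_sup_ball bO.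
exists (sup_ball M); split; first exact: compact_sup_ball.
have /closure_id -> : closed (@sup_ball R d M).
  by apply: compact_closed; [exact: norm_hausdorff|exact: compact_sup_ball].
exact: closure_subset.
Qed.

Lemma continuous_L2_domain f : continuous f -> L2 lebesgue Omega f.
Proof.
move=> cf; have [B [cB OB]] := closure_sup_ball.
apply: (@continuous_L2 _ _ _ _ _ _ B) => //.
  by apply: subset_trans OB; exact: subset_closure.
exact: bounded_lebesgue.
Qed.

Lemma is_wdiv_wdiv v : Hdiv Omega v -> is_wdiv Omega v (wdiv Omega v).
Proof. by move=> [_ ex]; exact: (xgetPex _ ex). Qed.

Lemma L2_wdiv v : Hdiv Omega v -> L2 lebesgue Omega (wdiv Omega v).
Proof. by move=> /is_wdiv_wdiv[]. Qed.

Lemma divergence_test_integrable v phi : L2v lebesgue Omega v -> C1 phi ->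
  lebesgue.-integrable Omega (EFin \o (fun x => \sum_i v x ord0 i * partial i phi x)).
Proof.
move=> Lv [_ cphi]; apply: integrable_sumR => // i.
by apply: L2M_integrable => //; [exact: Lv|exact: continuous_L2_domain].
Qed.

Lemma is_wdiv_lin (s : R) u v g h : L2v lebesgue Omega u -> L2v lebesgue Omega v ->
  is_wdiv Omega u g -> is_wdiv Omega v h ->
  is_wdiv Omega (s *: u + v) (fun x => s * g x + h x).
Proof.
move=> Lu Lv [Lg Hg] [Lh Hh]; split; first exact: L2_lin.
move=> phi [Cphi K]; have cphi := C1_continuous Cphi.
rewrite (@Rintegral_lin _ _ _ _ mO s (fun x => \sum_i u x ord0 i * partial i phi x)
   (fun x => \sum_i v x ord0 i * partial i phi x)).
- rewrite Hg// Hh// [in RHS](@Rintegral_lin _ _ _ _ mO s (fun x => g x * phi x) (fun x => h x * phi x)).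
  + by rewrite opprD mulrN.
  + by apply: L2M_integrable => //; exact: continuous_L2_domain.
  + by apply: L2M_integrable => //; exact: continuous_L2_domain.
  + by move=> x _; rewrite mulrDl mulrA.
- exact: divergence_test_integrable.
- exact: divergence_test_integrable.
- move=> x _; rewrite mulr_sumr -big_split; apply: eq_bigr => i _ /=.
  by rewrite !mxE mulrDl mulrA.
Qed.

Lemma is_wdiv_unique v g h : is_wdiv Omega v g -> is_wdiv Omega v h ->
  ae_on lebesgue Omega (fun x => g x = h x).
Proof.
move=> [Lg Hg] [Lh Hh].
have Lgh : L2 lebesgue Omega (fun x => (-1) * h x + g x) by exact: L2_lin.
have : ae_on lebesgue Omega (fun x => (-1) * h x + g x = 0).
  apply: fundamental_lemma => //.
    rewrite (_ : _ \o _ = EFin \o (fun x => ((-1) * h x + g x) * cst 1 x)).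
      by apply: L2M_integrable => //; apply: continuous_L2_domain => //; exact: cst_continuous.
    by apply/funext => x /=; rewrite mulr1.
  move=> phi Cphi; have cphi := C1_continuous Cphi.1.
  rewrite (@Rintegral_lin _ _ _ _ mO (-1) (fun x => h x * phi x) (fun x => g x * phi x)).
  - have := Hg phi Cphi; rewrite Hh// => /oppr_inj ->.
    by rewrite mulN1r addNr.
  - by apply: L2M_integrable => //; exact: continuous_L2_domain.
  - by apply: L2M_integrable => //; exact: continuous_L2_domain.
  - by move=> x _; rewrite mulrDl mulrA.
rewrite /ae_on; apply: filterS => x H Ox; have := H Ox; lra.
Qed.

(** The weak divergence is a chosen representative, so it is linear only a.e.:
both sides are weak divergences of the same field, and these are unique by the
fundamental lemma. *)
Lemma wdiv_lin (s : R) u v : Hdiv Omega u -> Hdiv Omega v -> Hdiv Omega (s *: u + v) ->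
  ae_on lebesgue Omega (fun x => wdiv Omega (s *: u + v) x = s * wdiv Omega u x + wdiv Omega v x).
Proof.
move=> Hu Hv Huv; apply: (is_wdiv_unique (is_wdiv_wdiv Huv)).
by apply: is_wdiv_lin; [exact: Hu.1|exact: Hv.1|exact: is_wdiv_wdiv|exact: is_wdiv_wdiv].
Qed.

Lemma Rintegral_wdiv_lin (s : R) u v q : Hdiv Omega u -> Hdiv Omega v ->
  Hdiv Omega (s *: u + v) -> L2 lebesgue Omega q ->
  \int[lebesgue]_(x in Omega) (wdiv Omega (s *: u + v) x * q x) =
  s * \int[lebesgue]_(x in Omega) (wdiv Omega u x * q x) +
  \int[lebesgue]_(x in Omega) (wdiv Omega v x * q x).
Proof.
move=> Hu Hv Huv Lq.
have Ldu := L2_wdiv Hu; have Ldv := L2_wdiv Hv.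
rewrite (@ae_eq_Rintegral _ _ _ _ mO _
  (fun x => (s * wdiv Omega u x + wdiv Omega v x) * q x)).
- apply: (@Rintegral_lin _ _ _ _ mO s (fun x => wdiv Omega u x * q x)
     (fun x => wdiv Omega v x * q x)).
  + exact: (L2M_integrable mO Ldu Lq).
  + exact: (L2M_integrable mO Ldv Lq).
  + by move=> x _; rewrite mulrDl mulrA.
- by apply: measurable_funM; [have [] := L2_wdiv Huv|have [] := Lq].
- apply: measurable_funM; last by have [] := Lq.
  by have [] := L2_lin mO s Ldu Ldv.
- have := wdiv_lin Hu Hv Huv; rewrite /ae_on; apply: filterS => x H Ox.
  by rewrite H.
Qed.

Context (bd_fin : (surface R d (bd Omega) < +oo)%E).

Lemma bd_measurable : measurable (bd Omega).
Proof.
apply: measurableD; first by apply: closed_rV_measurable; exact: closed_closure.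
by apply: open_rV_measurable; exact: open_interior.
Qed.

Lemma continuous_L2_bd f : continuous f -> L2 (surface R d) (bd Omega) f.
Proof.
move=> cf; have [B [cB OB]] := closure_sup_ball.
apply: (@continuous_L2 _ _ _ _ _ _ B) => //; first exact: bd_measurable.
by move=> x [Ox _]; exact: OB.
Qed.

(** Finiteness of the surface measure of the boundary makes test functions
square-integrable there, so that the boundary integrals split. *)
Lemma is_ntrace_lin (s : R) u v g h : Hdiv Omega u -> Hdiv Omega v ->
  Hdiv Omega (s *: u + v) -> is_ntrace Omega u g -> is_ntrace Omega v h ->
  is_ntrace Omega (s *: u + v) (fun x => s * g x + h x).
Proof.
move=> Hu Hv Huv [Lg Hg] [Lh Hh].
have mB := bd_measurable.
split; first exact: L2_lin.
move=> phi Cphi; have cphi := C1_continuous Cphi.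
have Lphi := continuous_L2_domain cphi; have LBphi := continuous_L2_bd cphi.
have iM w : Hdiv Omega w -> lebesgue.-integrable Omega
    (EFin \o (fun x => wdiv Omega w x * phi x)).
  by move=> Hw; apply: L2M_integrable => //; exact: L2_wdiv.
have iS w : Hdiv Omega w -> lebesgue.-integrable Omega
    (EFin \o (fun x => \sum_i w x ord0 i * partial i phi x)).
  by move=> Hw; apply: divergence_test_integrable => //; exact: Hw.1.
have splitI w : Hdiv Omega w ->
  \int[lebesgue]_(x in Omega) (wdiv Omega w x * phi x + \sum_i w x ord0 i * partial i phi x) =
  \int[lebesgue]_(x in Omega) (wdiv Omega w x * phi x) +
  \int[lebesgue]_(x in Omega) (\sum_i w x ord0 i * partial i phi x).
  by move=> Hw; rewrite RintegralD//; [exact: iM|exact: iS].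
have := Hh phi Cphi; have := Hg phi Cphi; rewrite !splitI//.
rewrite (Rintegral_wdiv_lin Hu Hv Huv Lphi).
rewrite (@Rintegral_lin _ _ _ _ mO s (fun x => \sum_i u x ord0 i * partial i phi x)
   (fun x => \sum_i v x ord0 i * partial i phi x)
   (fun x => \sum_i (s *: u + v) x ord0 i * partial i phi x)); last 3 first.
- exact: iS.
- exact: iS.
- move=> x _; rewrite mulr_sumr -big_split; apply: eq_bigr => i _ /=.
  by rewrite !mxE mulrDl mulrA.
move=> Eu Ev.
rewrite (@Rintegral_lin _ _ _ _ mB s (fun x => g x * phi x) (fun x => h x * phi x)
   (fun x => (s * g x + h x) * phi x)); last 3 first.
- exact: L2M_integrable.
- exact: L2M_integrable.
- by move=> x _; rewrite mulrDl mulrA.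
(* Over variables, so that the integrals are not compared up to conversion. *)
have alg (a b a' b' : R) : s * a + b + (s * a' + b') = s * (a + a') + (b + b').
  by rewrite mulrDr addrACA.
exact: etrans (alg _ _ _ _) (f_equal2 (fun a b => s * a + b) Eu Ev).
Qed.

End weak_divergence.

(** * The inverse coefficient matrix *)

Section coefficient.
Context (R : realType) (d : nat).
Implicit Types (K : 'M[R]_d) (x y u v : 'rV[R]_d).

Lemma dotE x y : dot x y = (x *m y^T) ord0 ord0.
Proof. by rewrite mxE; apply: eq_bigr => i _; rewrite mxE. Qed.

Lemma dot_ge0 x : 0 <= dot x x.
Proof. by apply: sumr_ge0 => i _; rewrite -expr2 sqr_ge0. Qed.

Lemma dot_eq0 x : dot x x <= 0 -> x = 0.
Proof.
move=> x0; apply/rowP => i; rewrite mxE.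
have : dot x x == 0 by rewrite eq_le x0 dot_ge0.
rewrite psumr_eq0; last by move=> j _; rewrite -expr2 sqr_ge0.
by move=> /allP/(_ i (mem_index_enum _)); rewrite /= mulf_eq0 orbb => /eqP.
Qed.

Lemma dot_lin (s : R) x y u : dot (s *: x + y) u = s * dot x u + dot y u.
Proof. by rewrite !dotE mulmxDl -scalemxAl !mxE. Qed.

Lemma dotC x y : dot x y = dot y x.
Proof. by apply: eq_bigr => i _; rewrite mulrC. Qed.

Definition spd (k1 : R) K := K^T = K /\ forall x, k1 * dot x x <= dot (K *m x^T)^T x.

Definition solve K u := (invmx K *m u^T)^T.

Context (k1 : R) (k1_gt0 : 0 < k1) (K : 'M[R]_d) (spdK : spd k1 K).

Lemma spd_unitmx : K \in unitmx.
Proof.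
have [KT Kc] := spdK.
rewrite -row_free_unit -kermx_eq0; apply/rowV0P => x /sub_kermxP xK.
apply: dot_eq0; have := Kc x.
have -> : K *m x^T = 0 by rewrite -KT -trmx_mul xK trmx0.
by rewrite trmx0 [leRHS]big1 ?pmulr_rle0// => i _; rewrite mxE mul0r.
Qed.

Lemma solveK u : (K *m (solve K u)^T)^T = u.
Proof. by rewrite /solve trmxK mulKVmx ?trmxK// spd_unitmx. Qed.

Lemma solve_coercive u : k1 * dot (solve K u) (solve K u) <= dot (solve K u) u.
Proof. by have := spdK.2 (solve K u); rewrite solveK [leRHS]dotC. Qed.

Lemma solve_ge0 u : 0 <= dot (solve K u) u.
Proof. by apply: le_trans (solve_coercive u); rewrite mulr_ge0 ?dot_ge0// ltW. Qed.

Lemma solve_definite u : dot (solve K u) u = 0 -> u = 0.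
Proof.
move=> u0; have := solve_coercive u; rewrite u0 pmulr_rle0// => /dot_eq0 w0.
by rewrite -(solveK u) w0 trmx0 mulmx0 trmx0.
Qed.

Lemma solve_sym u v : dot (solve K u) v = dot (solve K v) u.
Proof.
rewrite [RHS]dotC !dotE /solve !trmx_mul !trmxK trmx_inv spdK.1.
by rewrite mulmxA.
Qed.

(** Expand the nonnegative square of u - k1 w, where w solves K w = u, and use
coercivity. *)
Lemma solve_bound u : dot (solve K u) (solve K u) <= k1 ^- 2 * dot u u.
Proof.
set w := solve K u.
have h := solve_coercive u; rewrite -/w in h.
have : 0 <= dot (- k1 *: w + u) (- k1 *: w + u) by exact: dot_ge0.
rewrite dot_lin ![dot _ (- k1 *: w + u)]dotC !dot_lin [dot u w]dotC => h'.
have h2 := ler_wpM2l (ltW k1_gt0) h; rewrite ler_pdivlMl ?exprn_gt0//; nra.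
Qed.

End coefficient.

Lemma measurable_inv (R : realType) : measurable_fun setT (@GRing.inv R).
Proof.
rewrite -(setUv [set 0 : R]); apply/measurable_funU => //.
  exact: measurableC.
split; first exact: measurable_fun_set1.
have -> : ~` [set 0] = [set x : R | x != 0].
  by apply/seteqP; split => x /= /eqP.
apply: open_continuous_measurable_fun; first exact: open_neq.
by apply/in_setP => x /= x0; exact: inv_continuous.
Qed.

Section measurable_matrix.
Context (R : realType) (d : nat) (D : set 'rV[R]_d) (mD : measurable D).

Lemma measurable_det n (M : 'rV[R]_d -> 'M[R]_n) :
  (forall i j, measurable_fun D (fun x => M x i j)) ->
  measurable_fun D (fun x => \det (M x)).
Proof.
move=> mM; apply: measurable_sum => s; apply: measurable_funM => //.
by apply: measurable_prod => i _; exact: mM.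
Qed.

(** Entrywise by the cofactor formula, with a case distinction because invmx is
the identity on singular matrices. *)
Lemma measurable_invmx n (M : 'rV[R]_d -> 'M[R]_n) :
  (forall i j, measurable_fun D (fun x => M x i j)) ->
  forall i j, measurable_fun D (fun x => invmx (M x) i j).
Proof.
move=> mM i j.
have mdet := measurable_det mM.
have madj : measurable_fun D (fun x => (\adj (M x)) i j).
  rewrite (_ : (fun x => _) = fun x => cofactor (M x) j i); last first.
    by apply/funext => x; rewrite mxE.
  apply: measurable_funM => //; apply: measurable_det => k l.
  rewrite (_ : (fun x => _) = fun x => M x (lift j k) (lift i l))//.
  by apply/funext => x; rewrite !mxE.
rewrite (_ : (fun x => _) = fun x => if \det (M x) == 0 then M x i j
    else (\det (M x))^-1 * (\adj (M x)) i j); last first.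
  apply/funext => x; rewrite /invmx unitmxE unitfE; case: eqP => //= _.
  by rewrite mxE.
apply: measurable_fun_if => //.
- exact: measurable_fun_eqr.
- apply: measurable_funS (mM i j) => //; exact: subIsetl.
- have mV : measurable_fun D (fun x => (\det (M x))^-1).
    by apply: (measurableT_comp (f := @GRing.inv R)) => //; exact: measurable_inv.
  by apply: measurable_funS (measurable_funM mV madj) => //; exact: subIsetl.
Qed.

End measurable_matrix.

(** * The Darcy forms *)

Lemma polyhedral_finite (R : realType) (d : nat) (A : set 'rV[R]_d) : (0 < d)%N ->
  polyhedral_surface A -> (surface R d A < +oo)%E.
Proof.
case: d A => // k A _ [F [_ ->]].
elim: F => [|a F ih]; first by rewrite set_nil bigcup_set0 measure0.
have -> : \bigcup_(b in [set` a :: F]) simplex b =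
    simplex a `|` \bigcup_(b in [set` F]) simplex b.
  apply/seteqP; split => x.
    by move=> [b /=]; rewrite inE => /predU1P[->|bF] xb; [left|right; exists b].
  move=> [xa|[b /= bF xb]]; first by exists a => //=; rewrite mem_head.
  by exists b => //=; rewrite inE bF orbT.
apply: (le_lt_trans (outer_measureU2 (hausdorff k) _ _)).
by apply: lte_add_pinfty => //; exact: hausdorff_simplex.
Qed.

Section Darcy.
Context (R : realType) (d : nat) (d_gt0 : (0 < d)%N).
Context (P : stokes_darcy R d) (hP : admissible P).
Implicit Types (u v w : 'rV[R]_d -> 'rV[R]_d) (p q phi psi : 'rV[R]_d -> R).

Lemma OmegaD_open : open (OmegaD P).
Proof. by have [] := adm_domainD hP. Qed.

Lemma OmegaD_measurable : measurable (OmegaD P).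
Proof. exact: open_rV_measurable OmegaD_open. Qed.

Lemma OmegaD_subset : OmegaD P `<=` Omega P.
Proof.
by move=> x Dx; have [] : (Omega P `\` Sigma P) x by rewrite (adm_split hP); right.
Qed.

Lemma OmegaD_bounded : bounded_set (OmegaD P).
Proof.
have [M [Mr MO]] := adm_bounded hP; exists M; split => // r Mr' x Dx.
by apply: MO => //; exact: OmegaD_subset.
Qed.

(** A boundary point of OmegaD in Omega but not on the interface would lie in
one of the disjoint open sets OmegaS and OmegaD, and neither meets the boundary
of OmegaD. *)
Lemma bd_OmegaD_subset : bd (OmegaD P) `<=` bd (Omega P) `|` Sigma P.
Proof.
move=> x [cDx iDx].
have [oO _ _] := adm_domain hP; have [oS _ _] := adm_domainS hP.
have [Ox|Ox] := pselect (Omega P x); last first.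
  left; split; first exact: (closure_subset OmegaD_subset).
  by move=> /interior_subset.
have [Sx|Sx] := pselect (Sigma P x); first by right.
have : (OmegaS P `|` OmegaD P) x by rewrite -(adm_split hP).
case=> [Sx'|Dx]; last first.
  by exfalso; apply: iDx; apply: open_nbhs_nbhs; split => //; exact: OmegaD_open.
have [y [Dy Sy]] := cDx _ (open_nbhs_nbhs (conj oS Sx')).
exfalso; have : (OmegaS P `&` OmegaD P) y by [].
by rewrite (adm_disjoint hP).
Qed.

Lemma bd_OmegaD_finite : (surface R d (bd (OmegaD P)) < +oo)%E.
Proof.
apply: (@le_lt_trans _ _ (surface R d (bd (Omega P)) + surface R d (Sigma P))%E).
  apply: le_trans (outer_measureU2 (hausdorff d.-1) _ _).
  exact: (le_outer_measure (hausdorff d.-1) _ _ bd_OmegaD_subset).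
apply: lte_add_pinfty; apply: polyhedral_finite => //.
  exact: adm_polyhedral.
exact: adm_Sigma_polyhedral.
Qed.

Lemma K_spd : exists2 k1 : R, 0 < k1 & ae_on lebesgue (OmegaD P) (fun x => spd k1 (Kmx P x)).
Proof.
have [k1 [k2 [k10 aeK]]] := adm_K hP; exists k1 => //.
move: aeK; rewrite /ae_on; apply: filterS => x H Dx.
by have [KT Kc] := H Dx; split => // xi; have /andP[] := Kc xi.
Qed.

Let mD := OmegaD_measurable.
Local Notation L2D := (L2 lebesgue (OmegaD P)).
Local Notation L2vD := (L2v lebesgue (OmegaD P)).

Lemma L2_dot u v : L2vD u -> L2vD v ->
  lebesgue.-integrable (OmegaD P) (EFin \o (fun x => dot (u x) (v x))).
Proof.
move=> Lu Lv; apply: integrable_sumR => // i.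
by apply: L2M_integrable => //; [exact: Lu|exact: Lv].
Qed.

Lemma L2_solve u : L2vD u -> L2vD (fun x => solve (Kmx P x) (u x)).
Proof.
move=> Lu i.
have mi : measurable_fun (OmegaD P) (fun x => solve (Kmx P x) (u x) ord0 i).
  rewrite (_ : (fun x => _) = fun x => \sum_j invmx (Kmx P x) i j * u x ord0 j).
    apply: measurable_sum => j; apply: measurable_funM; last by have [] := Lu j.
    exact: measurable_invmx (adm_K_measurable hP) i j.
  by apply/funext => x; rewrite !mxE; apply: eq_bigr => j _; rewrite !mxE.
split => //.
have [k1 k10 aeK] := K_spd.
have Luu := L2_dot Lu Lu.
apply: (@le_lt_trans _ _ (\int[lebesgue]_(x in OmegaD P) ((k1 ^- 2)%:E * (dot (u x) (u x))%:E))%E).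
  apply: ae_ge0_le_integral => //.
  - by move=> x _; rewrite lee_fin sqr_ge0.
  - by apply/measurable_EFinP; exact: measurable_funX.
  - by move=> x _; rewrite -EFinM lee_fin mulr_ge0 ?dot_ge0// invr_ge0 sqr_ge0.
  - by apply: emeasurable_funM => //; have := measurable_int _ Luu.
  - move: aeK; rewrite /ae_on; apply: filterS => x H Dx.
    rewrite -EFinM lee_fin; apply: le_trans (solve_bound k10 (H Dx) (u x)).
    rewrite /coor /dot (bigD1 i)//= expr2 lerDl sumr_ge0// => j _.
    by rewrite -expr2 sqr_ge0.
apply: integrable_lty => //.
by apply: (integrableZl mD (k1 ^- 2)); exact: Luu.
Qed.

Lemma aD_integrable u v : L2vD u -> L2vD v ->
  lebesgue.-integrable (OmegaD P) (EFin \o (fun x => dot (solve (Kmx P x) (u x)) (v x))).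
Proof. by move=> Lu Lv; apply: L2_dot => //; exact: L2_solve. Qed.

Let measurable_aD u v : L2vD u -> L2vD v ->
  measurable_fun (OmegaD P) (fun x => dot (solve (Kmx P x) (u x)) (v x)).
Proof.
by move=> Lu Lv; apply/measurable_EFinP; exact: (measurable_int _ (aD_integrable Lu Lv)).
Qed.

Lemma aD_lin_r (s : R) u v w : L2vD u -> L2vD v -> L2vD w ->
  aD P w (s *: u + v) = s * aD P w u + aD P w v.
Proof.
move=> Lu Lv Lw.
apply: (@Rintegral_lin _ _ _ _ mD s (fun x => dot (solve (Kmx P x) (w x)) (u x))
  (fun x => dot (solve (Kmx P x) (w x)) (v x))).
- exact: aD_integrable.
- exact: aD_integrable.
- by move=> x _; rewrite dotC dot_lin ![dot _ (invmx _ *m _)^T]dotC.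
Qed.

Lemma aD_sym u v : L2vD u -> L2vD v -> aD P u v = aD P v u.
Proof.
move=> Lu Lv; have [k1 k10 aeK] := K_spd.
apply: ae_eq_Rintegral => //; [exact: measurable_aD|exact: measurable_aD|].
by move: aeK; rewrite /ae_on; apply: filterS => x H Dx; exact: solve_sym (H Dx) _ _.
Qed.

Lemma aD_lin_l (s : R) u v w : L2vD u -> L2vD v -> L2vD w -> L2vD (s *: u + v) ->
  aD P (s *: u + v) w = s * aD P u w + aD P v w.
Proof.
by move=> Lu Lv Lw Luv; rewrite aD_sym// aD_lin_r// (aD_sym Lw Lu) (aD_sym Lw Lv).
Qed.

Let aD_abs u : L2vD u ->
  ae_on lebesgue (OmegaD P) (fun x => dot (solve (Kmx P x) (u x)) (u x) =
    `|dot (solve (Kmx P x) (u x)) (u x)|).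
Proof.
move=> Lu; have [k1 k10 aeK] := K_spd.
move: aeK; rewrite /ae_on; apply: filterS => x H Dx.
by rewrite ger0_norm// (solve_ge0 k10 (H Dx)).
Qed.

Let aD_norm u : L2vD u -> aD P u u =
  \int[lebesgue]_(x in OmegaD P) `|dot (solve (Kmx P x) (u x)) (u x)|.
Proof.
move=> Lu; apply: ae_eq_Rintegral => //; first exact: measurable_aD.
- by apply: measurableT_comp => //; exact: measurable_aD.
- exact: aD_abs.
Qed.

Lemma aD_ge0 u : L2vD u -> 0 <= aD P u u.
Proof. by move=> Lu; rewrite aD_norm// Rintegral_ge0. Qed.

(** The integrand is nonnegative a.e., so it vanishes a.e., and K is positive
definite. *)
Lemma aD_definite u : L2vD u -> aD P u u = 0 ->
  ae_on lebesgue (OmegaD P) (fun x => u x = 0).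
Proof.
move=> Lu; rewrite aD_norm// => a0; have [k1 k10 aeK] := K_spd.
have mf := measurable_aD Lu Lu.
have : (\int[lebesgue]_(x in OmegaD P) `|(dot (solve (Kmx P x) (u x)) (u x))%:E| = 0)%E.
  rewrite -[LHS]fineK; first by congr EFin.
  apply: integrable_fin_num => //.
  by have := integrable_abse (aD_integrable Lu Lu).
have mfE : measurable_fun (OmegaD P) (fun x => (dot (solve (Kmx P x) (u x)) (u x))%:E).
  exact/measurable_EFinP.
move=> /ae_eq_integral_abs => /(_ mD mfE).
move: aeK; rewrite /ae_on; apply: filterS2 => x Kx H Dx.
apply: (solve_definite k10 (Kx Dx)).
by have := H Dx => -[].
Qed.

Lemma aD_ae0_r u v : L2vD u -> L2vD v ->
  ae_on lebesgue (OmegaD P) (fun x => v x = 0) -> aD P u v = 0.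
Proof.
move=> Lu Lv v0.
rewrite /aD (@ae_eq_Rintegral _ _ _ _ mD _ (fun=> 0)).
- by rewrite Rintegral_cst// mul0r.
- exact: measurable_aD.
- exact: measurable_cst.
- move: v0; rewrite /ae_on; apply: filterS => x H Dx.
  by rewrite H// /dot big1// => i _; rewrite [X in _ * X]mxE mulr0.
Qed.

Local Notation HdivD := (Hdiv (OmegaD P)).

Lemma bD_lin_l (s : R) u v q : HdivD u -> HdivD v -> HdivD (s *: u + v) -> L2D q ->
  bD P (s *: u + v) q = s * bD P u q + bD P v q.
Proof. exact: (Rintegral_wdiv_lin OmegaD_open OmegaD_bounded). Qed.

Lemma bD_lin_r (s : R) u p q : HdivD u -> L2D p -> L2D q ->
  bD P u (s *: p + q) = s * bD P u p + bD P u q.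
Proof.
move=> Hu Lp Lq; have Ldu := L2_wdiv Hu.
apply: (@Rintegral_lin _ _ _ _ mD s (fun x => wdiv (OmegaD P) u x * p x)
  (fun x => wdiv (OmegaD P) u x * q x)).
- exact: (L2M_integrable mD Ldu Lp).
- exact: (L2M_integrable mD Ldu Lq).
- by move=> x _ /=; rewrite mulrDr mulrCA.
Qed.

End Darcy.

(** * The discrete Darcy spaces *)

Section discrete.
Context (R : realType) (d : nat) (d_gt0 : (0 < d)%N).
Context (P : stokes_darcy R d) (hP : admissible P).
Context (S : discrete_spaces R d) (h0 : R) (hS : discretization P S h0).
Implicit Types (u v w : 'rV[R]_d -> 'rV[R]_d) (p q phi psi : 'rV[R]_d -> R).

Local Notation L2D := (L2 lebesgue (OmegaD P)).
Local Notation L2vD := (L2v lebesgue (OmegaD P)).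
Local Notation HdivD := (Hdiv (OmegaD P)).
Local Notation aeD := (ae_on lebesgue (OmegaD P)).
Let mD := OmegaD_measurable hP.

Lemma HD_subspace : subspace_of (HD S).
Proof. exact: (subspace_finite_dimensional (dis_HD_findim hS)). Qed.

Lemma HD_L2 u : HD S u -> L2vD u.
Proof. by move=> /(dis_HD hS)[]. Qed.

Lemma HhD_HD u : HhD P S u -> HD S u. Proof. by case. Qed.

Lemma Hh0_HhD u : Hh0 P S u -> HhD P S u.
Proof.
move=> [Hu [g [ng g0]]]; split => //; exists g; split => //.
by move: g0; rewrite /ae_on; apply: filterS => x H [Bx _]; exact: H.
Qed.

Lemma Hh0_HD u : Hh0 P S u -> HD S u. Proof. by case. Qed.

Lemma L0D_L2 q : L0D S q -> L2D q.
Proof. by move=> /(dis_L0D hS)[]. Qed.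

Lemma L0D_subspace : subspace_of (L0D S).
Proof. exact: (subspace_finite_dimensional (dis_L0D_findim hS)). Qed.

Lemma is_ntrace_HD (s : R) u v g h : HD S u -> HD S v ->
  is_ntrace (OmegaD P) u g -> is_ntrace (OmegaD P) v h ->
  is_ntrace (OmegaD P) (s *: u + v) (fun x => s * g x + h x).
Proof.
move=> Hu Hv; apply: is_ntrace_lin.
- exact: OmegaD_open hP.
- exact: OmegaD_bounded hP.
- exact: bd_OmegaD_finite.
- exact: dis_HD hS _ Hu.
- exact: dis_HD hS _ Hv.
- by apply: (dis_HD hS); apply: HD_subspace.2.
Qed.

Lemma is_ntrace0 : is_ntrace (OmegaD P) 0 (fun=> 0).
Proof.
have mB : measurable (bd (OmegaD P)) by exact: bd_measurable.
split; first exact: L2_0.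
move=> phi Cphi.
have Hd0 : HdivD 0 by apply: (dis_HD hS); exact: HD_subspace.1.
have wd0 : aeD (fun x => wdiv (OmegaD P) 0 x = 0).
  (* The zero field is (-1) times itself plus itself. *)
  have := @wdiv_lin _ _ _ (OmegaD_open hP) (OmegaD_bounded hP) (-1) 0 0 Hd0 Hd0.
  rewrite scaler0 addr0 => /(_ Hd0).
  by rewrite /ae_on; apply: filterS => x H Dx; have := H Dx; rewrite mulN1r addNr.
rewrite (@ae_eq_Rintegral _ _ _ _ mD _ (fun=> 0)); last 3 first.
- apply: measurable_funD.
    apply: measurable_funM; first by have [] := L2_wdiv Hd0.
    by apply: continuous_rV_measurable => //; exact: C1_continuous.
  have Lv0 : L2vD 0 by have [] := Hd0.
  have := divergence_test_integrable (OmegaD_open hP) (OmegaD_bounded hP) Lv0 Cphi.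
  by move=> /(measurable_int _)/measurable_EFinP.
- exact: measurable_cst.
- move: wd0; rewrite /ae_on; apply: filterS => x H Dx.
  by rewrite H// mul0r add0r big1// => i _; rewrite mxE mul0r.
transitivity (0 : R); first by rewrite Rintegral_cst// mul0r.
transitivity (\int[surface R d]_(x in bd (OmegaD P)) (0 : R)).
  by rewrite Rintegral_cst// mul0r.
by apply: eq_Rintegral => x _; rewrite mul0r.
Qed.

Lemma HhD_subspace : subspace_of (HhD P S).
Proof.
split.
  split; first exact: HD_subspace.1.
  by exists (fun=> 0); split; [exact: is_ntrace0|exact: aeW].
move=> s u v [Hu [g [ng g0]]] [Hv [h [nh h_0]]]; split; first exact: HD_subspace.2.
exists (fun x => s * g x + h x); split; first exact: is_ntrace_HD.
move: g0 h_0; rewrite /ae_on; apply: filterS2 => x Hg Hh Gx.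
by rewrite Hg// Hh// mulr0 addr0.
Qed.

Lemma Hh0_subspace : subspace_of (Hh0 P S).
Proof.
split.
  split; first exact: HD_subspace.1.
  by exists (fun=> 0); split; [exact: is_ntrace0|exact: aeW].
move=> s u v [Hu [g [ng g0]]] [Hv [h [nh h_0]]]; split; first exact: HD_subspace.2.
exists (fun x => s * g x + h x); split; first exact: is_ntrace_HD.
move: g0 h_0; rewrite /ae_on; apply: filterS2 => x Hg Hh Gx.
by rewrite Hg// Hh// mulr0 addr0.
Qed.

Lemma fluxD_lin (s : R) u v phi psi : HD S u -> HD S v ->
  fluxD P u phi -> fluxD P v psi -> fluxD P (s *: u + v) (fun x => s * phi x + psi x).
Proof.
move=> Hu Hv [g [ng g0 gS]] [h [nh h_0 hS']].
exists (fun x => s * g x + h x); split; first exact: is_ntrace_HD.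
- move: g0 h_0; rewrite /ae_on; apply: filterS2 => x Hg Hh Gx.
  by rewrite Hg// Hh// mulr0 addr0.
- move: gS hS'; rewrite /ae_on; apply: filterS2 => x Hg Hh Gx.
  by rewrite opprD -mulrN Hg// Hh.
Qed.

Lemma Hh0_flux0 u : Hh0 P S u -> fluxD P u (fun=> 0).
Proof.
move=> [Hu [g [ng g0]]]; exists g; split => //.
  by move: g0; rewrite /ae_on; apply: filterS => x H [Bx _]; exact: H.
move: g0; rewrite /ae_on; apply: filterS => x H Sx; rewrite H ?oppr0//.
by move: Sx; rewrite (adm_Sigma hP) => -[].
Qed.

Lemma flux0_Hh0 u phi : HD S u -> fluxD P u phi -> (forall x, phi x = 0) -> Hh0 P S u.
Proof.
move=> Hu [g [ng g0 gS]] phi0; split => //; exists g; split => //.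
move: g0 gS; rewrite /ae_on; apply: filterS2 => x Hg HS Bx.
have [Sx|Sx] := pselect (Sigma P x); last exact: Hg.
by have := HS Sx; rewrite phi0 => /eqP; rewrite oppr_eq0 => /eqP.
Qed.

Lemma fluxD_add_Hh0 u v phi : HD S u -> fluxD P u phi -> Hh0 P S v ->
  fluxD P (v + u) phi.
Proof.
move=> Hu fu Hv.
have := fluxD_lin 1 (Hh0_HD Hv) Hu (Hh0_flux0 Hv) fu.
rewrite scale1r (_ : (fun x => _) = phi)//.
by apply/funext => x; rewrite mulr0 add0r.
Qed.

(** The boundary of OmegaD is covered by GammaD and the interface, so a field
whose flux vanishes on the interface and on GammaD has zero normal trace. *)
Lemma fluxD_sub_Hh0 u v phi : HD S u -> HD S v -> fluxD P u phi -> fluxD P v phi ->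
  Hh0 P S (-1 *: u + v).
Proof.
move=> Hu Hv fu fv.
apply: (flux0_Hh0 (HD_subspace.2 (-1) _ _ Hu Hv) (fluxD_lin (-1) Hu Hv fu fv)).
by move=> x; rewrite mulN1r addNr.
Qed.

Lemma aD_HD_lin_l (s : R) u v w : HD S u -> HD S v -> HD S w ->
  aD P (s *: u + v) w = s * aD P u w + aD P v w.
Proof.
move=> Hu Hv Hw; apply: aD_lin_l => //; try exact: HD_L2.
by apply: HD_L2; exact: HD_subspace.2.
Qed.

Lemma aD_HD_lin_r (s : R) u v w : HD S u -> HD S v -> HD S w ->
  aD P w (s *: u + v) = s * aD P w u + aD P w v.
Proof. by move=> Hu Hv Hw; apply: aD_lin_r => //; exact: HD_L2. Qed.

Lemma bD_HD_lin_l (s : R) u v q : HD S u -> HD S v -> L0D S q ->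
  bD P (s *: u + v) q = s * bD P u q + bD P v q.
Proof.
move=> Hu Hv Lq; apply: bD_lin_l => //; try exact: (dis_HD hS).
- by apply: (dis_HD hS); exact: HD_subspace.2.
- exact: L0D_L2.
Qed.

Lemma bD_HD_lin_r (s : R) u p q : HD S u -> L0D S p -> L0D S q ->
  bD P u (s *: p + q) = s * bD P u p + bD P u q.
Proof. by move=> Hu Lp Lq; apply: bD_lin_r; [exact: hP|exact: (dis_HD hS)|exact: L0D_L2|exact: L0D_L2]. Qed.

End discrete.

(** * Solvability and the reduced problem *)

(** Over an abstract ring, so that the forms are not compared up to conversion. *)
Fact saddle_regroup (R : comRingType) (s a1 a2 b1 b2 c1 c2 : R) :
  s * a1 + a2 - (s * b1 + b2) + (s * c1 + c2) =
  s * (a1 - b1 + c1) + (a2 - b2 + c2).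
Proof. by ring. Qed.

Section solvability.
Context (R : realType) (d : nat) (d_gt0 : (0 < d)%N).
Context (P : stokes_darcy R d) (hP : admissible P).
Context (S : discrete_spaces R d) (h0 : R) (hS : discretization P S h0).
Context (beta : R) (beta_gt0 : 0 < beta).
Context (infsup : forall q, L0D S q ->
       beta * L2_norm (OmegaD P) q <=
       sup [set bD P u q / Hdiv_norm (OmegaD P) u | u in
             [set u | Hh0 P S u /\
                ~ ae_on lebesgue (OmegaD P) (fun x => u x = 0)]]).
Implicit Types (u v w : 'rV[R]_d -> 'rV[R]_d) (p q phi psi : 'rV[R]_d -> R).

Local Notation aeD := (ae_on lebesgue (OmegaD P)).
Let mD := OmegaD_measurable hP.
Let HDL u : Hh0 P S u -> HD S u. Proof. exact: Hh0_HD. Qed.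

(** If b(., q) vanishes, the supremum runs over a set that is empty or {0}; in
both cases it is 0, the supremum of the empty set being 0 by convention. *)
Lemma infsup_injective q : L0D S q -> (forall v, Hh0 P S v -> bD P v q = 0) ->
  aeD (fun x => q x = 0).
Proof.
move=> Lq bq; apply: (Rintegral_sqr_eq0 mD (L0D_L2 hS Lq)).
have : L2_norm (OmegaD P) q <= 0.
  rewrite -(pmulr_rle0 _ beta_gt0); apply: (le_trans (infsup Lq)).
  set A := [set _ | _ in _].
  have [->|A0] := eqVneq A set0; first by rewrite sup0.
  apply: ge_sup; first exact/set0P.
  by move=> _ [u [Hu _] <-]; rewrite bq// mul0r.
rewrite /L2_norm => n0.
have I0 : 0 <= \int[lebesgue]_(x in OmegaD P) (q x ^+ 2).
  by apply: Rintegral_ge0 => x _; exact: sqr_ge0.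
apply/eqP; rewrite eq_le I0 andbT -sqrtr_eq0.
by rewrite eq_le n0 sqrtr_ge0.
Qed.

(** Testing with v = u gives a(u, u) = b(u, p) = 0, so u = 0; then b(., p) = 0
and the inf-sup condition gives p = 0. *)
Lemma saddle_injective u p : Hh0 P S u -> L0D S p ->
  (forall v, Hh0 P S v -> aD P u v - bD P v p = 0) ->
  (forall q, L0D S q -> bD P u q = 0) ->
  aeD (fun x => u x = 0) /\ aeD (fun x => p x = 0).
Proof.
move=> Hu Lp au bu.
have u0 : aeD (fun x => u x = 0).
  apply: (aD_definite hP (HD_L2 hS (HDL Hu))).
  by have := au u Hu; rewrite bu// subr0.
split=> //; apply: infsup_injective => // v Hv.
have := au v Hv; rewrite (aD_sym hP (HD_L2 hS (HDL Hu)) (HD_L2 hS (HDL Hv))).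
rewrite (aD_ae0_r hP (HD_L2 hS (HDL Hv)) (HD_L2 hS (HDL Hu)) u0).
by rewrite sub0r => /eqP; rewrite oppr_eq0 => /eqP.
Qed.

(** By the Fredholm alternative it is enough that F and G vanish on the kernel
of the transposed saddle point form. By the symmetry of aD, an element (v, q) of
that kernel gives a solution (v, -q) of the homogeneous problem, so it is zero
a.e. *)
Lemma saddle_solvable (F : ('rV[R]_d -> 'rV[R]_d) -> R) (G : ('rV[R]_d -> R) -> R) :
  linear_on (Hh0 P S) F -> linear_on (L0D S) G ->
  (forall v, Hh0 P S v -> aeD (fun x => v x = 0) -> F v = 0) ->
  (forall q, L0D S q -> aeD (fun x => q x = 0) -> G q = 0) ->
  exists u p, [/\ Hh0 P S u, L0D S p,
    forall v, Hh0 P S v -> aD P u v - bD P v p = F v &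
    forall q, L0D S q -> bD P u q = G q].
Proof.
move=> lF lG F0 G0.
pose E := (('rV[R]_d -> 'rV[R]_d) * ('rV[R]_d -> R))%type.
pose W : set E := Hh0 P S `*` L0D S.
pose T (z t : E) : R := (aD P z.1 t.1 - bD P t.1 z.2) + bD P z.1 t.2.
have sH := Hh0_subspace d_gt0 hP hS; have sL := L0D_subspace hS.
have fW : finite_dimensional W.
  apply: finite_dimensional_prod; last exact: (dis_L0D_findim hS).
  exact: (finite_dimensional_subspace (dis_HD_findim hS) (@HDL) sH).
have sW : subspace_of W.
  split; first by split; [exact: sH.1|exact: sL.1].
  by move=> s z t [Hz Lz] [Ht Lt]; split; [exact: sH.2|exact: sL.2].
have [z [Hz Lz] zP] : exists2 z, W z & forall t : E, W t -> T z t = F t.1 + G t.2.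
  apply: fredholm => //.
  - move=> z [Hz Lz] s x y [Hx Lx] [Hy Ly]; rewrite /T /=.
    rewrite (aD_HD_lin_r hP hS)//; try exact: HDL.
    rewrite (bD_HD_lin_l hP hS)//; try exact: HDL.
    rewrite (bD_HD_lin_r hP hS)//; try exact: HDL.
    exact: saddle_regroup.
  - move=> z [Hz Lz] s x y [Hx Lx] [Hy Ly]; rewrite /T /=.
    rewrite (aD_HD_lin_l hP hS)//; try exact: HDL.
    rewrite (bD_HD_lin_r hP hS)//; try exact: HDL.
    rewrite (bD_HD_lin_l hP hS)//; try exact: HDL.
    exact: saddle_regroup.
  - by move=> s x y [Hx Lx] [Hy Ly] /=; rewrite lF// lG// mulrDr addrACA.
  - move=> [v q] [/= Hv Lq] ker.
    have a0 : aD P 0 v = 0.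
      apply: (@linear_on0 _ _ _ (aD P ^~ v) sH) => s x y Hx Hy.
      by rewrite (aD_HD_lin_l hP hS)//; exact: HDL.
    have b0l r : L0D S r -> bD P 0 r = 0.
      move=> Lr; apply: (@linear_on0 _ _ _ (bD P ^~ r) sH) => s x y Hx Hy.
      by rewrite (bD_HD_lin_l hP hS)//; exact: HDL.
    have b0r u : Hh0 P S u -> bD P u 0 = 0.
      move=> Hu; apply: (@linear_on0 _ _ _ (bD P u) sL) => s x y Hx Hy.
      by rewrite (bD_HD_lin_r hP hS)//; exact: HDL.
    have av w : Hh0 P S w -> aD P w v + bD P w q = 0.
      by move=> Hw; have := ker (w, 0) (conj Hw sL.1); rewrite /T /= b0r// subr0.
    have bv r : L0D S r -> bD P v r = 0.
      move=> Lr; have := ker (0, r) (conj sH.1 Lr); rewrite /T /= a0 b0l// sub0r addr0.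
      by move=> /eqP; rewrite oppr_eq0 => /eqP.
    have [v0 q0] : aeD (fun x => v x = 0) /\ aeD (fun x => (-1 *: q + 0) x = 0).
      apply: saddle_injective => //; first exact: sL.2 (-1) _ _ Lq sL.1.
      move=> w Hw; rewrite (bD_HD_lin_r hP hS (-1) (HDL Hw) Lq sL.1) b0r//.
      rewrite (aD_sym hP (HD_L2 hS (HDL Hv)) (HD_L2 hS (HDL Hw))).
      by rewrite addr0 mulN1r opprK av.
    rewrite F0// G0 ?addr0//.
    move: q0; rewrite /ae_on; apply: filterS => x H Dx.
    have : -1 * q x + 0 = 0 := H Dx; lra.
exists z.1, z.2; split => //.
- move=> v Hv; have := zP (v, 0) (conj Hv sL.1); rewrite /T /=.
  rewrite (linear_on0 sL lG) addr0 (@linear_on0 _ _ _ (bD P z.1) sL) ?addr0//.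
  by move=> s x y Hx Hy; rewrite (bD_HD_lin_r hP hS)//; exact: HDL.
- move=> q Lq; have := zP (0, q) (conj sH.1 Lq); rewrite /T /=.
  rewrite (linear_on0 sH lF) add0r.
  rewrite (@linear_on0 _ _ _ (aD P z.1) sH); last first.
    by move=> s x y Hx Hy; rewrite (aD_HD_lin_r hP hS)//; exact: HDL.
  rewrite (@linear_on0 _ _ _ (bD P ^~ z.2) sH) ?subr0 ?add0r//.
  by move=> s x y Hx Hy; rewrite (bD_HD_lin_l hP hS)//; exact: HDL.
Qed.

Lemma PhiD0 : PhiD P S (fun=> 0).
Proof.
split; first exact: L2_0.
exists 0; first exact: (HhD_subspace d_gt0 hP hS).1.
exact: (Hh0_flux0 hP (Hh0_subspace d_gt0 hP hS).1).
Qed.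

(** If g has no projection, Rh g is the default value 0, which is in PhiD. *)
Lemma Rh_PhiD g : PhiD P S (Rh P S g).
Proof. by rewrite /Rh; case: xgetP => [phi _ []//|_]; exact: PhiD0. Qed.

(** Lift the boundary datum to v0 and solve for the correction in Hh0. *)
Lemma flux_solutionP phi : PhiD P S phi -> is_flux_solution P S phi (flux_solution P S phi).
Proof.
move=> [_ [v0 Hv0 fv0]]; apply: (xgetPex (fun=> 0, fun=> 0)).
have Dv0 := HhD_HD Hv0.
have Lv0 := HD_L2 hS Dv0.
have [||||u [p [Hu Lp au bu]]] :=
    @saddle_solvable (fun v => - aD P v0 v) (fun q => - bD P v0 q).
- move=> s x y Hx Hy; rewrite (aD_HD_lin_r hP hS) ?opprD ?mulrN//; exact: HDL.
- by move=> s x y Hx Hy; rewrite (bD_HD_lin_r hP hS)// opprD mulrN.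
- by move=> v Hv v_0; rewrite (aD_ae0_r hP Lv0 (HD_L2 hS (HDL Hv)) v_0) oppr0.
- move=> q Lq q0; apply/eqP; rewrite oppr_eq0; apply/eqP.
  rewrite /bD; under eq_Rintegral do rewrite mulrC.
  apply: Rintegral_ae_eq0 => //; first by have [] := L0D_L2 hS Lq.
  by have [] := L2_wdiv (dis_HD hS Dv0).
have Du := HDL Hu.
have E : 1 *: u + v0 = u + v0 by rewrite scale1r.
exists (u + v0, p); split => /=.
- split => //; rewrite -E.
  by apply: (HhD_subspace d_gt0 hP hS).2 => //; exact: Hh0_HhD.
- exact: (fluxD_add_Hh0 d_gt0 hP hS).
- move=> v Hv; rewrite -E (aD_HD_lin_l hP hS 1 Du Dv0 (HDL Hv)).
  by rewrite mul1r addrAC au// addNr.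
- move=> q Lq; rewrite -E (bD_HD_lin_l hP hS 1 Du Dv0 Lq).
  by rewrite mul1r bu// addNr.
Qed.

Lemma source_solutionP : is_source_solution P S (source_solution P S).
Proof.
apply: (xgetPex (fun=> 0, fun=> 0)).
have [LfD _] := adm_fD hP.
have [||||u [p [Hu Lp au bu]]] :=
    @saddle_solvable (fun=> 0) (fun q => \int[lebesgue]_(x in OmegaD P) (fD P x * q x)).
- by move=> s x y _ _; rewrite mulr0 addr0.
- move=> s x y Lx Ly.
  apply: (@Rintegral_lin _ _ _ _ mD s (fun t => fD P t * x t) (fun t => fD P t * y t)).
  + exact: (L2M_integrable mD LfD (L0D_L2 hS Lx)).
  + exact: (L2M_integrable mD LfD (L0D_L2 hS Ly)).
  + by move=> t _; rewrite /= mulrDr mulrCA.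
- by [].
- move=> q Lq q0; under eq_Rintegral do rewrite mulrC.
  by apply: Rintegral_ae_eq0 => //; [have [] := L0D_L2 hS Lq|have [] := LfD].
by exists (u, p); split.
Qed.

(** Two fields with the same flux differ by an element of Hh0, on which the
residual of z vanishes; so the functional depends on the flux only. *)
Lemma normal_functionalE (z : ('rV[R]_d -> 'rV[R]_d) * ('rV[R]_d -> R)) v psi :
  HD S z.1 -> L0D S z.2 ->
  (forall v, Hh0 P S v -> aD P z.1 v - bD P v z.2 = 0) ->
  HhD P S v -> fluxD P v psi ->
  normal_functional P S z psi = aD P z.1 v - bD P v z.2.
Proof.
move=> Hz Lz az Hv fv.
suff ex : [set r : R | forall v, HhD P S v -> fluxD P v psi ->
    r = aD P z.1 v - bD P v z.2] (aD P z.1 v - bD P v z.2).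
  exact: (xgetPex 0 (ex_intro _ _ ex)).
move=> v' Hv' fv'.
have Dv := HhD_HD Hv; have Dv' := HhD_HD Hv'.
have := az _ (fluxD_sub_Hh0 d_gt0 hP hS Dv Dv' fv fv').
rewrite (aD_HD_lin_r hP hS (-1) Dv Dv' Hz) (bD_HD_lin_l hP hS (-1) Dv Dv' Lz).
move: (aD _ _ _) (aD _ _ _) (bD _ _ _) (bD _ _ _) => a b c e; lra.
Qed.

Lemma FtPE phi psi v : PhiD P S phi -> HhD P S v -> fluxD P v psi ->
  FtP P S phi psi =
  aD P (flux_solution P S phi).1 v - bD P v (flux_solution P S phi).2.
Proof.
move=> /flux_solutionP[[Hu Lp] fu au bu] Hv fv.
exact: (normal_functionalE (HhD_HD Hu) Lp au Hv fv).
Qed.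

Lemma gamma_fE psi v : HhD P S v -> fluxD P v psi ->
  gamma_f P S psi =
  aD P (source_solution P S).1 v - bD P v (source_solution P S).2.
Proof.
have [[Hu Lp] au bu] := source_solutionP => Hv fv.
exact: (normal_functionalE (HDL Hu) Lp au Hv fv).
Qed.

(** Use the flux solution of psi itself as the extension of psi: its divergence
is orthogonal to the pressure of the flux solution of phi. *)
Lemma FtP_energy phi psi : PhiD P S phi -> PhiD P S psi ->
  FtP P S phi psi = aD P (flux_solution P S phi).1 (flux_solution P S psi).1.
Proof.
move=> Hphi Hpsi; have [[Hu Lp] fu au bu] := flux_solutionP Hphi.
have [[Hv Lq] fv av bv] := flux_solutionP Hpsi.
by rewrite (FtPE Hphi Hv fv) bv// subr0.
Qed.

(** The sum of the source solution and of the flux solution for phi carries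
the flux phi and the source fD, and its residual on fluxes psi is what the
reduced problem contains. *)
Lemma darcy_reconstruction phi : PhiD P S phi ->
  let uD := (source_solution P S).1 + (flux_solution P S phi).1 in
  let pD := (source_solution P S).2 + (flux_solution P S phi).2 in
  [/\ HhD P S uD /\ L0D S pD, fluxD P uD phi,
    forall v, Hh0 P S v -> aD P uD v - bD P v pD = 0,
    forall v psi, HhD P S v -> fluxD P v psi ->
      aD P uD v - bD P v pD = FtP P S phi psi + gamma_f P S psi &
    forall q, L0D S q -> bD P uD q = \int[lebesgue]_(x in OmegaD P) (fD P x * q x)].
Proof.
move=> Hphi uD pD.
have [[Hu Lp] au bu] := source_solutionP.
have [[Hv Lq] fv av bv] := flux_solutionP Hphi.
have Du := HDL Hu; have Dv := HhD_HD Hv.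
have uE : uD = 1 *: (source_solution P S).1 + (flux_solution P S phi).1 by rewrite scale1r.
have pE : pD = 1 *: (source_solution P S).2 + (flux_solution P S phi).2 by rewrite scale1r.
split.
- split; rewrite ?uE ?pE; last exact: (L0D_subspace hS).2.
  by apply: (HhD_subspace d_gt0 hP hS).2 => //; exact: Hh0_HhD.
- exact: (fluxD_add_Hh0 d_gt0 hP hS).
- move=> w Hw; have Dw := HDL Hw; have := au w Hw; have := av w Hw.
  rewrite uE pE.
  rewrite (aD_HD_lin_l hP hS 1 Du Dv Dw) (bD_HD_lin_r hP hS 1 Dw Lp Lq).
  move: (aD _ _ _) (aD _ _ _) (bD _ _ _) (bD _ _ _) => a b c e; lra.
- move=> w psi Hw fw; have Dw := HhD_HD Hw.
  rewrite (FtPE Hphi Hw fw) (gamma_fE Hw fw) uE pE.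
  rewrite (aD_HD_lin_l hP hS 1 Du Dv Dw) (bD_HD_lin_r hP hS 1 Dw Lp Lq).
  move: (aD _ _ _) (aD _ _ _) (bD _ _ _) (bD _ _ _) => a b c e; lra.
- move=> q Lq'; rewrite uE (bD_HD_lin_l hP hS 1 Du Dv Lq').
  by rewrite mul1r bu// bv// addr0.
Qed.

Lemma bS0 u : bS P u (fun=> 0) = 0.
Proof.
have [oS _ _] := adm_domainS hP.
rewrite /bS; transitivity (\int[lebesgue]_(x in OmegaS P) (0 : R)).
  by apply: eq_Rintegral => x _; rewrite mulr0.
by rewrite Rintegral_cst ?mul0r//; exact: open_rV_measurable.
Qed.

Lemma bD0 u : bD P u (fun=> 0) = 0.
Proof.
rewrite /bD; transitivity (\int[lebesgue]_(x in OmegaD P) (0 : R)).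
  by apply: eq_Rintegral => x _; rewrite mulr0.
by rewrite Rintegral_cst ?mul0r.
Qed.

Lemma LhS0 : LhS S (fun=> 0).
Proof.
exists 0, 0; split; last by apply/funext => x; rewrite addr0.
exact: (subspace_finite_dimensional (dis_L0S_findim hS)).1.
Qed.

(** To isolate the Darcy equations, subtract the coupled equation tested with
(uS, uD) from the one tested with (uS, v + uD), where v is in Hh0; both pairs
are in Xh because adding v does not change the flux. *)
Lemma coupled_Darcy uS uD pS pD : solves_coupled P S (uS, uD) (pS, pD) ->
  [/\ forall v, Hh0 P S v -> aD P uD v - bD P v pD = 0,
    forall q, L0D S q -> bD P uD q = \int[lebesgue]_(x in OmegaD P) (fD P x * q x) &
    forall q, LhS S q -> bS P uS q = 0].
Proof.
move=> [[/= VuS HuD fuD] [/= LpS LpD] eq1 eq2].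
have Du := HhD_HD HuD.
split.
- move=> v Hv; have Dv := HDL Hv.
  have := eq1 (uS, uD) (And3 VuS HuD fuD).
  have /eq1 : Xh P S (uS, 1 *: v + uD).
    split => //=.
      by apply: (HhD_subspace d_gt0 hP hS).2 => //; exact: Hh0_HhD.
    by rewrite scale1r; exact: (fluxD_add_Hh0 d_gt0 hP hS).
  rewrite /= (aD_HD_lin_r hP hS 1 Dv Du Du) (bD_HD_lin_l hP hS 1 Dv Du LpD).
  move: (aS _ _ _) (bS _ _ _) (aD _ _ _) (aD _ _ _) (bD _ _ _) (bD _ _ _) (Rintegral _ _ _).
  by move=> a b c e f g i; lra.
- move=> q Lq; have := eq2 (fun=> 0, q) (conj LhS0 Lq).
  by rewrite /= bS0 add0r.
- move=> q Lq; have := eq2 (q, fun=> 0) (conj Lq (L0D_subspace hS).1).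
  rewrite /= bD0 addr0 => ->; transitivity (\int[lebesgue]_(x in OmegaD P) (0 : R)).
    by apply: eq_Rintegral => x _; rewrite mulr0.
  by rewrite Rintegral_cst ?mul0r.
Qed.

(** The pair (uD, pD) and the sum of the source and flux solutions have the same
flux and satisfy the same Darcy equations, so they agree a.e. by injectivity;
the residual of (uD, pD) on fluxes is then that of the sum. *)
Lemma coupled_reduced uS uD pS pD : solves_coupled P S (uS, uD) (pS, pD) ->
  let phi := Rh P S (fluxS P uS) in
  [/\ solves_reduced P S uS pS,
    aeD (fun x => uD x = (source_solution P S).1 x + (flux_solution P S phi).1 x) &
    aeD (fun x => pD x = (source_solution P S).2 x + (flux_solution P S phi).2 x)].
Proof.
move=> sol phi; have [aD0 bDf bS_0] := coupled_Darcy sol.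
have [[/= VuS HuD fuD] [/= LpS LpD] eq1 _] := sol.
have [[HuD' LpD'] fuD' aD0' aDF bDf'] := darcy_reconstruction (Rh_PhiD (fluxS P uS)).
move: HuD' LpD' fuD' aD0' aDF bDf'; rewrite -/phi.
set uD' := _ + _; set pD' := _ + _ => HuD' LpD' fuD' aD0' aDF bDf'.
have Du := HhD_HD HuD; have Du' := HhD_HD HuD'.
have Hw := fluxD_sub_Hh0 d_gt0 hP hS Du Du' fuD fuD'.
have Lw := (L0D_subspace hS).2 (-1) _ _ LpD LpD'.
(* The differences solve the homogeneous Darcy problem. *)
have [w0 p0] : aeD (fun x => (-1 *: uD + uD') x = 0) /\ aeD (fun x => (-1 *: pD + pD') x = 0).
  apply: saddle_injective => // [v Hv|q Lq].
    have Dv := HDL Hv; have := aD0 v Hv; have := aD0' v Hv.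
    rewrite (aD_HD_lin_l hP hS (-1) Du Du' Dv) (bD_HD_lin_r hP hS (-1) Dv LpD LpD').
    move: (aD _ _ _) (aD _ _ _) (bD _ _ _) (bD _ _ _) => a b c e; lra.
  by rewrite (bD_HD_lin_l hP hS (-1) Du Du' Lq) bDf// bDf'// mulN1r addNr.
split.
- split => // v Vv; set psi := Rh P S (fluxS P v).
  have [_ [vD HvD fvD]] := Rh_PhiD (fluxS P v).
  have DvD := HhD_HD HvD.
  have : aS P uS v + aD P uD vD - (bS P v pS + bD P vD pD) =
    \int[lebesgue]_(x in OmegaS P) dot (fS P x) (v x) := eq1 (v, vD) (And3 Vv HvD fvD).
  have := aDF vD psi HvD fvD.
  have : aD P (-1 *: uD + uD') vD = 0.
    rewrite (aD_sym hP (HD_L2 hS (HDL Hw)) (HD_L2 hS DvD)).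
    exact: (aD_ae0_r hP (HD_L2 hS DvD) (HD_L2 hS (HDL Hw)) w0).
  have : bD P vD (-1 *: pD + pD') = 0.
    rewrite /bD; under eq_Rintegral do rewrite mulrC.
    apply: (Rintegral_ae_eq0 mD) => //; first by have [] := L0D_L2 hS Lw.
    by have [] := L2_wdiv (dis_HD hS DvD).
  rewrite (aD_HD_lin_l hP hS (-1) Du Du' DvD) (bD_HD_lin_r hP hS (-1) DvD LpD LpD').
  rewrite -[lh P S v]/(\int[lebesgue]_(x in OmegaS P) dot (fS P x) (v x) - gamma_f P S psi).
  rewrite -[ch P S uS v]/(FtP P S phi psi).
  move: (aS _ _ _) (bS _ _ _) (aD _ _ _) (aD _ _ _) (bD _ _ _) (bD _ _ _).
  move: (FtP _ _ _ _) (gamma_f _ _ _) (Rintegral _ _ _) => r1 r2 r3 r4 r5 r6 r7 r8 r9; lra.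
- move: w0; rewrite /ae_on; apply: filterS => x H Dx.
  have E : -1 *: uD x + uD' x = 0 := H Dx.
  apply/eqP; rewrite -subr_eq0 -oppr_eq0 opprB addrC; apply/eqP.
  by rewrite -[RHS]E scaleN1r.
- move: p0; rewrite /ae_on; apply: filterS => x H Dx.
  have E : -1 * pD x + pD' x = 0 := H Dx.
  have E' : pD' x = (source_solution P S).2 x + (flux_solution P S phi).2 x by [].
  by rewrite -E'; lra.
Qed.

Lemma reduced_coupled uS pS : solves_reduced P S uS pS ->
  let phi := Rh P S (fluxS P uS) in
  let uD := fun x => (source_solution P S).1 x + (flux_solution P S phi).1 x in
  let pD := fun x => (source_solution P S).2 x + (flux_solution P S phi).2 x in
  solves_coupled P S (uS, uD) (pS, pD).
Proof.
move=> [VuS LpS eq1 eq2] phi uD pD.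
have [[HuD LpD] fuD _ aDF bDf] := darcy_reconstruction (Rh_PhiD (fluxS P uS)).
split.
- by split.
- by split.
- move=> [v vD] [/= Vv HvD fvD].
  have : aD P uD vD - bD P vD pD =
    FtP P S phi (Rh P S (fluxS P v)) + gamma_f P S (Rh P S (fluxS P v)) := aDF vD _ HvD fvD.
  have : aS P uS v + FtP P S phi (Rh P S (fluxS P v)) - bS P v pS =
    \int[lebesgue]_(x in OmegaS P) dot (fS P x) (v x) - gamma_f P S (Rh P S (fluxS P v)) :=
    eq1 v Vv.
  move: (aS _ _ _) (bS _ _ _) (aD _ _ _) (bD _ _ _).
  move: (FtP _ _ _ _) (gamma_f _ _ _) (Rintegral _ _ _) => r1 r2 r3 r4 r5 r6 r7; lra.
- by move=> [q1 q2] [/= Lq1 Lq2]; rewrite eq2// add0r; exact: bDf.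
Qed.

End solvability.

(** * Equivalence of the coupled and reduced problems *)

Unset Implicit Arguments.

Theorem mainTheorem4 (R : realType) (d : nat) (d23 : d = 2%N \/ d = 3%N)
  (P : stokes_darcy R d) (hP : admissible P)
  (hs : set R) (hs_gt0 : forall h, hs h -> 0 < h)
  (S : R -> discrete_spaces R d)
  (hS : forall h, hs h -> discretization P (S h) h)
  (hreg : shape_regular
     [set a | exists2 h, hs h & a \in TS (S h) ++ TD (S h)])
  (infsup : exists2 beta : R, 0 < beta & forall h, hs h ->
     forall q, L0D (S h) q ->
       beta * L2_norm (OmegaD P) q <=
       sup [set bD P u q / Hdiv_norm (OmegaD P) u | u in
             [set u | Hh0 P (S h) u /\
                ~ ae_on lebesgue (OmegaD P) (fun x => u x = 0)]])
  (div_incl : forall h, hs h -> forall v, HD (S h) v ->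
     exists2 q, LhD (S h) q &
       ae_on lebesgue (OmegaD P) (fun x => wdiv (OmegaD P) v x = q x)) :
  forall h, hs h ->
  (forall phi psi, PhiD P (S h) phi -> PhiD P (S h) psi ->
     [/\ FtP P (S h) phi psi =
           aD P (flux_solution P (S h) phi).1 (flux_solution P (S h) psi).1,
         aD P (flux_solution P (S h) phi).1 (flux_solution P (S h) psi).1 =
           FtP P (S h) psi phi &
         0 <= FtP P (S h) phi phi]) /\
  (forall uS uD pS pD,
     solves_coupled P (S h) (uS, uD) (pS, pD) ->
     let phi := Rh P (S h) (fluxS P uS) in
     [/\ solves_reduced P (S h) uS pS,
         ae_on lebesgue (OmegaD P) (fun x =>
           uD x = (source_solution P (S h)).1 x +
                  (flux_solution P (S h) phi).1 x) &
         ae_on lebesgue (OmegaD P) (fun x =>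
           pD x = (source_solution P (S h)).2 x +
                  (flux_solution P (S h) phi).2 x)]) /\
  (forall uS pS,
     solves_reduced P (S h) uS pS ->
     let phi := Rh P (S h) (fluxS P uS) in
     let uD := fun x => (source_solution P (S h)).1 x +
                        (flux_solution P (S h) phi).1 x in
     let pD := fun x => (source_solution P (S h)).2 x +
                        (flux_solution P (S h) phi).2 x in
     solves_coupled P (S h) (uS, uD) (pS, pD)).
Proof.
move=> h hsh.
have d_gt0 : (0 < d)%N by case: d23 => ->.
have [beta beta_gt0 isup] := infsup.
have dis := hS h hsh; have isup_h := isup h hsh.
split; [|split].
- move=> phi psi Hphi Hpsi.
  have [[Hu _] _ _ _] := flux_solutionP d_gt0 hP dis beta_gt0 isup_h Hphi.
  have [[Hv _] _ _ _] := flux_solutionP d_gt0 hP dis beta_gt0 isup_h Hpsi.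
  have Lu := HD_L2 dis (HhD_HD Hu); have Lv := HD_L2 dis (HhD_HD Hv).
  have E := FtP_energy d_gt0 hP dis beta_gt0 isup_h.
  split.
  + exact: (E phi psi Hphi Hpsi).
  + exact: (etrans (aD_sym hP Lu Lv) (esym (E psi phi Hpsi Hphi))).
  + by rewrite (E phi phi Hphi Hphi); exact: (aD_ge0 hP Lu).
- exact: (coupled_reduced d_gt0 hP dis beta_gt0 isup_h).
- exact: (reduced_coupled d_gt0 hP dis beta_gt0 isup_h).
Qed.
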